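(* Let $q\in(1,\infty]$, let $p$ be the Hölder conjugate of $q$ (i.e. $1/p+1/q=1$), let $r\in\mathbb{N}$, and let $\psi:\mathbb{R}\to[0,\infty)$ be a probability density which is symmetric around $0$, i.e. $\psi(x)=\psi(-x)$, and which satisfies $$\int_0^\infty\int_0^t\int_0^{y_r}\cdots\int_0^{y_2}\left(\int_0^\infty(x-y_1)^{r-1}\mathbf{1}_{[y_1,\infty)}(x)\,\psi(x)\,\mathrm{d}x\right)^{p-1}\mathrm{d}y_1\cdots\mathrm{d}y_r\ \psi(t)\,\mathrm{d}t<\infty.$$ Then $\psi$-weighted integration in $W_{0,q}^{(r,r,\ldots,r)}(\mathbb{R}^d)$ suffers from the curse of dimensionality; in more detail, $$N(\varepsilon,d)\ge2^d\,(1-\varepsilon)\quad\text{for all }\varepsilon\in(0,1)\text{ and }d\in\mathbb{N}.$$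
   Context: $\mathbb{N}=\{1,2,\dots\}$; for $p=1$ the power $(\cdot)^{p-1}$ is read as $1$. For $d=1$, $W_{0,q}^r(\mathbb{R})$ is the space of all $f:\mathbb{R}\to\mathbb{R}$ such that $f^{(j)}(0)=0$ for $0\le j<r$, $f^{(r-1)}$ is absolutely continuous (on every compact interval) and $f^{(r)}\in L_q(\mathbb{R})$, with norm $\|f\|_{1,q}=\|f^{(r)}\|_{L_q}$. The space $F_d=W_{0,q}^{(r,\ldots,r)}(\mathbb{R}^d)$ is the $d$-fold tensor product of $W_{0,q}^r(\mathbb{R})$ with itself, equipped with the crossnorm $\|f\|_{d,q}=\|f^{(r,r,\ldots,r)}\|_{L_q}$, where $f^{(r,\ldots,r)}$ is the mixed partial derivative of order $r$ in each variable and the $L_q$-norm is over $\mathbb{R}^d$. $\psi$-weighted integration: $I_d(f)=\int_{\mathbb{R}^d}f(\boldsymbol{t})\psi(t_1)\cdots\psi(t_d)\,\mathrm{d}\boldsymbol{t}$. Initial error: $e(0,d)=\sup\{|I_d(f)|: f\in F_d,\ \|f\|_{d,q}\le1\}$. A linear algorithm is $A_{d,N}(f)=\sum_{k=1}^Na_kf(\boldsymbol{x}_k)$ with $\boldsymbol{x}_k\in\mathbb{R}^d$, $a_k\in\mathbb{R}$; its worst-case error is $e(F_d,A_{d,N})=\sup\{|I_d(f)-A_{d,N}(f)|: f\in F_d,\ \|f\|_{d,q}\le1\}$; $e(N,d)$ is the infimum of this over all linear algorithms using $N$ nodes; $N(\varepsilon,d)=\min\{N\in\mathbb{N}: e(N,d)\le\varepsilon\,e(0,d)\}$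 ($=\infty$ if no such $N$ exists). Curse of dimensionality: for some fixed $\varepsilon>0$, $N(\varepsilon,d)$ grows at least exponentially fast in $d$. *)

(* Defs.v *)
From HB Require Import structures.
From mathcomp Require Import all_boot all_order all_algebra.
From mathcomp Require Import all_classical all_reals all_analysis.
Set Implicit Arguments.
Unset Strict Implicit.
Unset Printing Implicit Defensive.
Import Order.TTheory GRing.Theory Num.Theory.
Import numFieldNormedType.Exports.
Local Open Scope classical_set_scope.
Local Open Scope ring_scope.

(* measurableTypeR R, not R: this is the copy of R that carries
   lebesgue_measure. *)
Definition Rn (R : realType) (d : nat) := d.-tuple (measurableTypeR R).
HB.instance Definition _ (R : realType) (d : nat) := Measurable.on (Rn R d).

Section lebesgue_step.
Context {R : realType} {d : nat}.

Definition Rn_cons (x : measurableTypeR R * Rn R d) : Rn R d.+1 :=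
  [tuple of x.1 :: x.2].

Definition Rn_uncons (x : Rn R d.+1) : measurableTypeR R * Rn R d :=
  (thead x, [tuple of behead x]).

Lemma Rn_consK : cancel Rn_cons Rn_uncons.
Proof.
by case=> x t; rewrite /Rn_uncons /= theadE; congr pair; apply/val_inj.
Qed.

Let measurable_Rn_cons : measurable_fun [set: _] Rn_cons.
Proof. exact: measurable_cons. Qed.

HB.instance Definition _ := isMeasurableFun.Build _ _ _ _
  Rn_cons measurable_Rn_cons.

Lemma measurable_Rn_uncons : measurable_fun [set: _] Rn_uncons.
Proof.
apply/measurable_fun_pair => /=; last exact: measurable_behead.
exact: (@measurable_tnth _ (measurableTypeR R) d.+1 ord0).
Qed.

Variable mu : {sigma_finite_measure set (Rn R d) -> \bar R}.

Definition lebesgue_step : set (Rn R d.+1) -> \bar R :=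
  pushforward (@lebesgue_measure R \x mu)%E Rn_cons.

Let step0 : lebesgue_step set0 = 0%E.
Proof. exact: measure0. Qed.

Let step_ge0 A : (0 <= lebesgue_step A)%E.
Proof. exact: measure_ge0. Qed.

Let step_sigma_additive : semi_sigma_additive lebesgue_step.
Proof. exact: measure_semi_sigma_additive. Qed.

HB.instance Definition _ := isMeasure.Build _ _ _ lebesgue_step
  step0 step_ge0 step_sigma_additive.

Let step_sigma_finite : sigma_finite setT lebesgue_step.
Proof.
have /sigma_finiteP[F [TF ndF Foo]] := sigma_finiteT (@lebesgue_measure R).
have /sigma_finiteP[G [TG ndG Goo]] := sigma_finiteT mu.
exists (fun n => Rn_uncons @^-1` (F n `*` G n)).
  rewrite -preimage_bigcup; apply/esym/seteqP; split => // x _ /=.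
  have [i _ Fi] : (\bigcup_i F i) (Rn_uncons x).1 by rewrite -TF.
  have [j _ Gj] : (\bigcup_i G i) (Rn_uncons x).2 by rewrite -TG.
  exists (maxn i j) => //; split.
    by apply: (subsetPset _ _ (ndF _ _ (leq_maxl i j))).
  by apply: (subsetPset _ _ (ndG _ _ (leq_maxr i j))).
move=> n; have [mF Fn] := Foo n; have [mG Gn] := Goo n.
split.
  rewrite -[X in measurable X]setTI.
  by apply: measurable_Rn_uncons => //; exact: measurableX.
rewrite /lebesgue_step /pushforward -comp_preimage.
rewrite (_ : _ \o _ = id); last by apply/funext => x; exact: Rn_consK.
by rewrite preimage_id product_measure1E// lte_mul_pinfty// ge0_fin_numE.
Qed.

HB.instance Definition _ := Measure_isSigmaFinite.Build _ _ _ lebesgue_step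
  step_sigma_finite.

End lebesgue_step.

Fixpoint lebesgue_Rn (R : realType) (d : nat) :
    {sigma_finite_measure set (Rn R d) -> \bar R} :=
  match d with
  | 0 => [the {sigma_finite_measure set (Rn R 0) -> \bar R}
            of \d_([tuple] : Rn R 0)]
  | d'.+1 => [the {sigma_finite_measure set (Rn R d'.+1) -> \bar R}
            of lebesgue_step (lebesgue_Rn R d')]
  end.

Lemma lebesgue_Rn_box (R : realType) (d : nat)
    (A : 'I_d -> set (measurableTypeR R)) :
  (forall i, measurable (A i)) ->
  lebesgue_Rn R d [set x | forall i, A i (tnth x i)] =
  (\prod_(i < d) lebesgue_measure (A i))%E.
Proof.
elim: d A => [|d IHd] A mA.
  by rewrite big_ord0 /= diracE mem_set // => -[].
rewrite big_ord_recl -IHd //=.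
rewrite -product_measure1E //; last first.
  rewrite (_ : mkset _ = \bigcap_i ((fun x => tnth x i) @^-1` A (lift ord0 i))).
    apply: fin_bigcap_measurable => [|i _]; first exact: finite_finset.
    by rewrite -[X in measurable X]setTI; exact: measurable_tnth.
  by apply/seteqP; split => x /= h i; [move=> _|]; exact: h.
rewrite /lebesgue_step /pushforward; congr product_measure1.
apply/seteqP; split => -[x t] /=.
  move=> h; split; first by have := h ord0; rewrite /Rn_cons tnth0.
  by move=> i; have := h (lift ord0 i); rewrite /Rn_cons tnthS.
case=> h0 h i; case: (unliftP ord0 i) => [j ->|->].
  by rewrite /Rn_cons tnthS.
by rewrite /Rn_cons tnth0.
Qed.

Section sobolev.
Context {R : realType}.

Definition absolutely_continuous (a b : R) (f : R -> R) : Prop :=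
  forall e : R, 0 < e -> exists2 dl : R, 0 < dl &
    forall (n : nat) (u v : 'I_n -> R),
      (forall i, [/\ a <= u i, u i <= v i & v i <= b]) ->
      (forall i j, i != j -> v i <= u j \/ v j <= u i) ->
      \sum_i (v i - u i) < dl -> \sum_i `|f (v i) - f (u i)| < e.

(* f belongs to L_q(mu), as a class modulo mu-negligible sets, with
   representative g. Functions such as f^(r) below are only determined almost
   everywhere: derive1n takes a junk value where the derivative does not
   exist. *)
Definition Lq_representative d (T : measurableType d)
    (mu : {measure set T -> \bar R}) (q : \bar R) (f g : T -> R) : Prop :=
  g \in Lfun mu q /\ {ae mu, forall x, f x = g x}.

(* f is in W_{0,q}^r(R). For r = 1 there is no derivability requirement beyond
   absolute continuity of f itself. *)
Definition sobolev0 (r : nat) (q : \bar R) (f : R -> R) : Prop :=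
  [/\ forall j, (j < r)%N -> derive1n j f 0 = 0,
      forall j x, (j.+1 < r)%N -> derivable (derive1n j f) x 1,
      forall a b, absolutely_continuous a b (derive1n r.-1 f)
    & exists g, Lq_representative (@lebesgue_measure R) q (derive1n r f) g].

Variable d : nat.
Implicit Types (f G : Rn R d -> R) (x : Rn R d) (i : 'I_d).

Definition set_coord x i (t : R) : Rn R d :=
  [tuple if j == i then t else tnth x j | j < d].

Definition partial_derivative (r : nat) i f : Rn R d -> R :=
  fun x => derive1n r (fun t : R => f (set_coord x i t)) (tnth x i).

(* f^(r,...,r), as an iterated classical derivative *)
Definition mixed_derivative (r : nat) f : Rn R d -> R :=
  foldr (partial_derivative r) f (enum 'I_d).

Definition algebraic_tensor (r : nat) (q : \bar R) : set (Rn R d -> R) :=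
  [set f | exists n (g : 'I_n -> 'I_d -> R -> R),
     (forall k j, sobolev0 r q (g k j)) /\
     f = (fun x => \sum_(k < n) \prod_(j < d) g k j (tnth x j))].

(* The d-fold tensor product of the Banach space W_{0,q}^r(R) is the completion
   of the algebraic tensor product for the crossnorm ||f^(r,...,r)||_q. Point
   evaluations are continuous for this norm, so the completion is a space of
   functions: f is the pointwise limit of f_n, and G, the L_q-limit of
   f_n^(r,...,r), is the derivative f^(r,...,r). Constant sequences give back
   the algebraic tensor product with its classical mixed derivative. *)
Definition tensor_mixed_derivative (r : nat) (q : \bar R) f G : Prop :=
  G \in Lfun (lebesgue_Rn R d) q /\
  exists (f_ G_ : nat -> Rn R d -> R),
    [/\ forall n, algebraic_tensor r q (f_ n),
        forall n, Lq_representative (lebesgue_Rn R d) q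
                    (mixed_derivative r (f_ n)) (G_ n),
        forall x, f_ n x @[n --> \oo] --> f x
      & ('N[lebesgue_Rn R d]_q[EFin \o (G_ n \- G)%R] @[n --> \oo]
           --> 0)%E].

(* The f in F_d with ||f||_{d,q} <= 1; G is determined by f up to a null set. *)
Definition tensor_unit_ball (r : nat) (q : \bar R) : set (Rn R d -> R) :=
  [set f | exists2 G, tensor_mixed_derivative r q f G &
     ('N[lebesgue_Rn R d]_q[EFin \o G] <= 1)%E].

End sobolev.

Section integration.
Context {R : realType}.
Variables (r : nat) (q : \bar R) (psi : R -> R).

Definition weighted_integral (d : nat) (f : Rn R d -> R) : \bar R :=
  (\int[lebesgue_Rn R d]_x (f x * \prod_(j < d) psi (tnth x j))%:E)%E.

Definition initial_error (d : nat) : \bar R :=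
  ereal_sup [set `|weighted_integral f|%E
    | f in @tensor_unit_ball R d r q].

Definition linear_algorithm (d N : nat) (a : 'I_N -> R) (x : 'I_N -> Rn R d)
    (f : Rn R d -> R) : R :=
  \sum_(k < N) a k * f (x k).

Definition worst_case_error (d N : nat) (a : 'I_N -> R)
    (x : 'I_N -> Rn R d) : \bar R :=
  ereal_sup [set `|weighted_integral f - (linear_algorithm a x f)%:E|%E
    | f in @tensor_unit_ball R d r q].

Definition minimal_error (N d : nat) : \bar R :=
  ereal_inf [set e | exists (a : 'I_N -> R) (x : 'I_N -> Rn R d),
    e = worst_case_error a x].

(* The infimum of a nonempty set of naturals is its minimum, and the
   infimum of the empty set is +oo *)
Definition information_complexity (eps : R) (d : nat) : \bar R :=
  ereal_inf [set N%:R%:E | N in [set N : nat | (1 <= N)%N /\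
    (minimal_error N d <= eps%:E * initial_error d)%E]].

Definition curse_of_dimensionality : Prop :=
  exists eps C gamma : R, [/\ 0 < eps, 0 < C, 0 < gamma &
    forall d, (1 <= d)%N ->
      ((C * (1 + gamma) ^+ d)%:E <= information_complexity eps d)%E].

End integration.

Section integrability.
Context {R : realType}.

(* \int_0^t \int_0^{y_r} ... \int_0^{y_2} h(y_1) dy_1 ... dy_r *)
Fixpoint iterated_integral (r : nat) (h : R -> \bar R) (t : R) : \bar R :=
  match r with
  | 0 => h t
  | r'.+1 => (\int[lebesgue_measure]_(y in `[0%R, t]) iterated_integral r' h y)%E
  end.

Definition psi_tail (r : nat) (psi : R -> R) (y : R) : \bar R :=
  (\int[lebesgue_measure]_(x in `[0%R, +oo[)
     ((x - y) ^+ r.-1 * \1_(`[y, +oo[) x * psi x)%:E)%E.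

(* The convention 0 `^ 0 = +oo `^ 0 = 1 of poweR is the one wanted for p = 1. *)
Definition psi_condition (r : nat) (p : R) (psi : R -> R) : Prop :=
  (\int[lebesgue_measure]_(t in `[0%R, +oo[)
     (iterated_integral r (fun y => psi_tail r psi y `^ (p - 1)%R) t
        * (psi t)%:E) < +oo)%E.

End integrability.

(* Main.v *)
(* For a node set of size N fewer than 2^d, keep the set S of those orthants
   that contain no node. If f is in the unit ball and b is a vector of signs,
   reflecting f by b and then cutting it off outside the orthants of S gives
   another function of the unit ball, because all derivatives of order < r
   vanish on the coordinate hyperplanes. This function is zero at all nodes, so
   its integral is at most the worst-case error e. Since psi is symmetric, the
   integrals for the 2^d choices of b add up to #|S| times the integral of f,
   whence (2^d - N) e(0,d) <= 2^d e. It remains to see that 0 < e(0,d) < oo.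
   Finiteness comes from the Taylor formula f(x) = int K(x,y) f^(r,...,r)(y) dy
   on the positive orthant, Tonelli and Hoelder's inequality: the integral
   condition on psi says that int K(x,.) psi(x) dx is in L_p. *)
From HB Require Import structures.
Require Import Defs.
From mathcomp Require Import all_boot all_order all_algebra.
From mathcomp Require Import all_classical all_reals all_analysis.
From mathcomp Require Import measurable_realfun ess_sup_inf ring lra.
Set Implicit Arguments.
Unset Strict Implicit.
Unset Printing Implicit Defensive.
Import Order.TTheory GRing.Theory Num.Theory.
Import numFieldNormedType.Exports.
Local Open Scope classical_set_scope.
Local Open Scope ring_scope.

(** * Absolutely continuous functions *)

(** The analytic weight lies in the Taylor formula. [sobolev0] gives absolute continuity of the
    derivative of order r - 1 in epsilon-delta form and a classical r-th derivative that exists only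
    almost everywhere, so one first has to show that such a function is the integral of its
    derivative. This goes through the Jordan decomposition, the Stieltjes measures of its two
    monotone parts, the Radon-Nikodym theorem and Lebesgue differentiation. A second obstacle is
    that the unit ball consists of limits. Folding and the kernel bound are proved for sums of
    elementary tensors, where everything factors over the coordinates, and are then passed to the
    limit: folding because it is linear and does not increase the norm, the integral bound by
    Fatou's lemma. The initial error is positive because the ball contains a product of bumps, the
    r-th derivative of each factor being the indicator of ]0, 1[. Both its positivity and its
    finiteness are needed to cancel it at the end. *)

Section absolute_continuity_variation.
Context {R : realType}.
Implicit Types (a b x y e dl : R) (u F : R -> R) (s : seq (R * R)).

Definition itv_separated (i j : R * R) := (i.2 <= j.1) || (j.2 <= i.1).

(** Lists replace the indexed families of [absolutely_continuous], so that intervals can be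
    subdivided by concatenation; they need not be sorted. *)
Definition nonoverlapping a b s :=
  all (fun i => [&& a <= i.1, i.1 <= i.2 & i.2 <= b]) s && pairwise itv_separated s.

Definition total_length s := \sum_(i <- s) (i.2 - i.1).

Definition total_oscillation u s := \sum_(i <- s) `|u i.2 - u i.1|.

Lemma absolutely_continuous_seq a b u e : absolutely_continuous a b u -> 0 < e ->
  exists2 dl, 0 < dl & forall s, nonoverlapping a b s ->
    total_length s < dl -> total_oscillation u s < e.
Proof.
move=> acu /acu[dl dl0 acdl]; exists dl => // s /andP[/allP sab sep].
rewrite /total_length /total_oscillation (big_nth (0, 0)) big_mkord => slt.
rewrite (big_nth (0, 0)) big_mkord.
apply: (acdl (size s) (fun i => (nth (0, 0) s i).1)
  (fun i => (nth (0, 0) s i).2)) => //.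
  by move=> i; apply/and3P; apply: sab; exact: mem_nth.
move=> i j; rewrite -(inj_eq val_inj) neq_ltn => ij.
have /(pairwiseP (0, 0)) := sep.
case/orP: ij => ij /(_ _ _ _ _ ij) => /(_ (ltn_ord _) (ltn_ord _)) /orP[];
  by [left|right].
Qed.

Fixpoint partition_steps x (l : seq R) : seq (R * R) :=
  if l is y :: l' then (x, y) :: partition_steps y l' else [::].

Lemma variation_steps x y u l :
  variation x y u l = total_oscillation u (partition_steps x l).
Proof.
rewrite /variation /total_oscillation; elim: l x => [|z l ih] x /=.
  by rewrite big_geq // big_nil.
rewrite big_nat_recl //= big_cons; congr (_ + _).
by rewrite -ih; apply: eq_bigr => -[|i] _.
Qed.

Lemma partition_steps_length x y l : itv_partition x y l ->
  total_length (partition_steps x l) = y - x.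
Proof.
rewrite /total_length; elim: l x => [|z l ih] x.
  by move=> /itv_partition_nil ->; rewrite big_nil subrr.
move=> /itv_partition_cons /= h; rewrite big_cons ih //= .
by rewrite addrC subrKA.
Qed.

Lemma partition_steps_nonoverlapping x y l : itv_partition x y l ->
  nonoverlapping x y (partition_steps x l).
Proof.
elim: l x => [|z l ih] x //= h.
have [hx _] := h; move: hx => /= /andP[xz _].
have zy := itv_partition_cons h.
have lezy : z <= y by exact: itv_partition_le zy.
have /andP[/allP il sl] := ih _ zy.
apply/andP; split => /=.
  rewrite lexx ltW //= lezy /=.
  apply/allP => i /il /and3P[zi -> ->]; rewrite andbT andbT.
  by rewrite (le_trans (ltW xz)).
rewrite sl andbT; apply/allP => i /il /and3P[zi _ _].
by rewrite /itv_separated /= zi.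
Qed.

(* The union of a family of disjoint intervals, some of them subdivided, is
   again a family of disjoint intervals with the same total length: taking the
   supremum over the subdivisions turns oscillations into variations. *)
Lemma sum_total_variation_le a b u e dl :
  bounded_variation a b u ->
  (forall s, nonoverlapping a b s -> total_length s < dl ->
     total_oscillation u s <= e) ->
  forall s, nonoverlapping a b s -> total_length s < dl ->
    \sum_(i <- s) fine (total_variation i.1 i.2 u) <= e.
Proof.
move=> bvu osc s sab sdl.
(* Intervals of [s'] contribute variations, those of [t] only oscillations. The induction moves the
   head of [s'], cut by an arbitrary partition, into [t]. *)
suff H s' t : nonoverlapping a b (s' ++ t) -> total_length (s' ++ t) < dl ->
    \sum_(i <- s') fine (total_variation i.1 i.2 u) + total_oscillation u t <= e.
  by have := H s [::]; rewrite cats0 /total_oscillation big_nil addr0; apply.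
elim: s' t => [|i s' ih] t; first by rewrite big_nil add0r; exact: osc.
rewrite big_cons /nonoverlapping /= => /andP[/andP[/and3P[ai ii ib] al]].
move=> /andP[sepi sep] len.
rewrite -addrA -lerBrDr.
have fin : total_variation i.1 i.2 u \is a fin_num.
  apply/bounded_variationP => //; apply: (bounded_variationl ii ib).
  exact: (bounded_variationr ai (le_trans ii ib)).
rewrite -lee_fin fineK //; apply: ge_ereal_sup => _ [_ [l pl <-] <-].
rewrite lee_fin variation_steps lerBrDr addrCA -[X in _ + X]big_cat /=.
rewrite -/(total_oscillation u (partition_steps i.1 l ++ t)); apply: ih.
- have /andP[/allP il sl] := partition_steps_nonoverlapping pl.
  move: al sepi sep.
  rewrite /nonoverlapping !all_cat !pairwise_cat => /andP[-> ->].
  move=> /andP[/allP seps' /allP sept] /and3P[st s's' tt].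
  rewrite s's' sl tt /= !andbT allrel_catr st /=.
  rewrite andbT; apply/and3P; split.
  + apply/allP => j /il /and3P[ij -> ji].
    by rewrite (le_trans ai ij) (le_trans ji).
  + apply/allrelP => j k /seps' + /il /and3P[ik kk ki].
    rewrite /itv_separated => /orP[h|h].
      by rewrite (le_trans ki h) orbT.
    by rewrite (le_trans h ik).
  + apply/allrelP => k j /il /and3P[ik kk ki] /sept.
    rewrite /itv_separated => /orP[h|h].
      by rewrite (le_trans ki h).
    by rewrite (le_trans h ik) orbT.
- move: len; rewrite /total_length big_cons !big_cat /= => /le_lt_trans; apply.
  rewrite -/(total_length (partition_steps i.1 l)) (partition_steps_length pl).
  by rewrite addrCA.
Qed.

(** With [dl] chosen for oscillation 1, each interval of length at most dl / 2 has variation at most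
    1, and finitely many of them cover [a, b]. *)
Lemma absolutely_continuous_bounded_variation a b u : a <= b ->
  absolutely_continuous a b u -> bounded_variation a b u.
Proof.
move=> ab acu.
have [dl dl0 osc] := absolutely_continuous_seq acu ltr01.
suff H n x : a <= x <= b -> x - a <= n%:R * (dl / 2) ->
    (total_variation a x u <= n%:R%:E)%E.
  apply/bounded_variationP => //; rewrite ge0_fin_numE ?total_variation_ge0 //.
  have := H (Num.bound ((b - a) / (dl / 2))) b.
  rewrite ab lexx => /(_ isT) h; apply: (le_lt_trans (h _)); last by rewrite ltry.
  rewrite -ler_pdivrMr ?divr_gt0 //; apply/ltW/archi_boundP.
  by rewrite divr_ge0 ?subr_ge0 // divr_ge0 // ltW.
elim: n x => [|n ih] x /andP[ax xb] h.
  have -> : x = a by apply/eqP; rewrite eq_le ax andbT -subr_le0 (le_trans h)// mul0r.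
  by rewrite total_variationxx.
(* One step back from [x], stopped at [a]; half of [dl] keeps the length strictly below [dl]. *)
pose c := Num.max a (x - dl / 2).
have ac : a <= c by rewrite le_max lexx.
have cx : c <= x by rewrite ge_max ax /= gerBl ltW // divr_gt0.
rewrite (total_variationD u ac cx) -natr1 EFinD leeD //.
  apply: ih; first by rewrite ac (le_trans cx).
  rewrite lerBlDr ge_max lerDr mulr_ge0 ?ler0n ?(ltW (divr_gt0 dl0 _)) //=.
  by rewrite lerBlDr addrAC -lerBlDr (le_trans h) // -natr1 mulrDl mul1r.
apply: ge_ereal_sup => _ [_ [l pl <-] <-]; rewrite lee_fin variation_steps ltW //.
apply: osc.
  have /andP[/allP il sl] := partition_steps_nonoverlapping pl.
  rewrite /nonoverlapping sl andbT; apply/allP => i /il /and3P[ci -> ix].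
  by rewrite (le_trans ac ci) (le_trans ix xb).
rewrite (partition_steps_length pl) /c.
by rewrite ltrBlDr -ltrBlDl lt_max; apply/orP; right; lra.
Qed.

(** Absolute continuity of a nondecreasing function: no absolute values are needed, and the
    inequality is weak because a supremum over partitions loses strictness. *)
Definition modulus_bound a b F := forall e, 0 < e -> exists2 dl, 0 < dl &
  forall s, nonoverlapping a b s -> total_length s < dl ->
    \sum_(i <- s) (F i.2 - F i.1) <= e.

(** F1 is the variation of [u] on [a, x] and F2 = F1 - u. [sum_total_variation_le] makes them
    inherit the modulus of [u]. *)
Lemma jordan_absolutely_continuous a b u : a <= b -> absolutely_continuous a b u ->
  exists F1 F2 : R -> R, [/\ {in `[a, b] &, nondecreasing_fun F1},
    {in `[a, b] &, nondecreasing_fun F2}, modulus_bound a b F1,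
    modulus_bound a b F2 & {in `[a, b], forall x, u x = F1 x - F2 x}].
Proof.
move=> ab acu; have bvu := absolutely_continuous_bounded_variation ab acu.
have fin x y : a <= x -> x <= y -> y <= b -> total_variation x y u \is a fin_num.
  move=> ax xy yb; apply/bounded_variationP => //.
  apply: (bounded_variationl xy yb).
  exact: (bounded_variationr ax (le_trans xy yb)).
pose F x := fine (total_variation a x u).
have FB x y : a <= x -> x <= y -> y <= b -> F y - F x = fine (total_variation x y u).
  move=> ax xy yb; rewrite /F (total_variationD u ax xy) fineD ?fin //.
    by rewrite addrC addKr.
  exact: le_trans xy yb.
have uF x y : a <= x -> x <= y -> y <= b -> `|u y - u x| <= F y - F x.
  move=> ax xy yb; rewrite FB // -lee_fin fineK ?fin //.
  exact: total_variation_ge.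
exists F, (fun x => F x - u x); split.
- move=> x y /[!in_itv]/= /andP[ax xb] /andP[ay yb] xy.
  by rewrite -subr_ge0 (le_trans _ (uF _ _ ax xy yb)).
- move=> x y /[!in_itv]/= /andP[ax xb] /andP[ay yb] xy.
  rewrite -subr_ge0; have := le_trans (ler_norm _) (uF _ _ ax xy yb); lra.
- move=> e e0; have [dl dl0 osc] := absolutely_continuous_seq acu e0.
  exists dl => // s sab sdl.
  have := @sum_total_variation_le a b u e dl bvu _ s sab sdl.
  move=> /(_ (fun s h k => ltW (osc s h k))); apply: le_trans.
  rewrite big_seq [leRHS]big_seq; apply: ler_sum => i si.
  by have /andP[/allP /(_ _ si) /and3P[? ? ?] _] := sab; rewrite FB.
(* An increment of F1 - u is at most a variation plus an oscillation, each taking half of [e]. *)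
- move=> e e0; have e20 : 0 < e / 2 by rewrite divr_gt0.
  have [dl dl0 osc] := absolutely_continuous_seq acu e20.
  exists dl => // s sab sdl.
  have h1 := @sum_total_variation_le a b u _ dl bvu
    (fun s h k => ltW (osc s h k)) s sab sdl.
  have h2 := ltW (osc _ sab sdl).
  rewrite [leRHS]splitr (le_trans _ (lerD h1 h2)) // -big_split /=.
  rewrite big_seq [leRHS]big_seq; apply: ler_sum => i si.
  have /andP[/allP /(_ _ si) /and3P[? ? ?] _] := sab; rewrite -FB //.
  have := ler_norm (- (u i.2 - u i.1)); rewrite normrN; lra.
- by move=> x _; rewrite subKr.
Qed.

End absolute_continuity_variation.

(** * Absolutely continuous functions as indefinite integrals *)

Section density.
Context {R : realType}.
Implicit Types (a b x y e dl : R) (F : R -> R).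
Local Notation mu := (@lebesgue_measure R).

(** Composing with this projection onto [a, b] extends a function by constants to the line, where a
    Stieltjes measure can be formed. *)
Definition clamp a b x := Num.max a (Num.min b x).

Lemma clamp_itv a b x : a <= b -> a <= clamp a b x <= b.
Proof. by move=> ab; rewrite /clamp le_max lexx ge_max ab ge_min lexx. Qed.

Lemma clamp_id a b x : a <= x <= b -> clamp a b x = x.
Proof. by move=> /andP[ax xb]; rewrite /clamp (min_r xb) (max_r ax). Qed.

Lemma clamp_le a b x y : x <= y -> clamp a b x <= clamp a b y.
Proof.
by move=> xy; rewrite /clamp /Num.max /Num.min; case: (ltP b x) => ?;
  case: (ltP b y) => ?; case: ltP => ?; case: ltP => ?; lra.
Qed.

Lemma clamp_dist a b x y : x <= y -> clamp a b y - clamp a b x <= y - x.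
Proof.
by move=> xy; rewrite /clamp /Num.max /Num.min; case: (ltP b x) => ?;
  case: (ltP b y) => ?; case: ltP => ?; case: ltP => ?; lra.
Qed.

Lemma disjoint_intervals_sup_inf (I J : set R) : is_interval I -> is_interval J ->
  I `&` J = set0 -> I !=set0 -> J !=set0 -> sup I <= inf J \/ sup J <= inf I.
Proof.
have H (I' J' : set R) x y : is_interval I' -> is_interval J' ->
    I' `&` J' = set0 -> I' x -> J' y -> x <= y -> sup I' <= inf J'.
  move=> iI iJ IJ0 Ix Jy xy.
  apply: ge_sup; first by exists x.
  move=> i Ii; apply: lb_le_inf; first by exists y.
  move=> j Jj; rewrite leNgt; apply/negP => ji.
  have [jx|xj] := leP j x.
    have : (I' `&` J') x by split => //; apply: iJ Jj Jy _ _; rewrite jx xy.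
    by rewrite IJ0.
  have : (I' `&` J') j by split => //; apply: iI Ix Ii _ _; rewrite !ltW.
  by rewrite IJ0.
move=> iI iJ IJ0 [x Ix] [y Jy]; have [xy|/ltW yx] := leP x y.
  by left; exact: (H _ _ x y).
by right; apply: (H _ _ y x) => //; rewrite setIC.
Qed.

Lemma stieltjes_itv (G : cumulative R R) x y : x <= y ->
  lebesgue_stieltjes_measure G `]x, y]%classic = (G y - G x)%:E.
Proof.
move=> xy; rewrite /lebesgue_stieltjes_measure /measure_extension /=.
rewrite measurable_mu_extE; last exact: is_ocitv.
exact: wlength_itv_bnd.
Qed.

(** The half-open hull is used because its Stieltjes measure is an increment of the function; the
    length bound ties that increment to the Lebesgue measure of I. *)
Lemma open_interval_bounds (I : set R) x y : open I -> is_interval I ->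
    I !=set0 -> I `<=` `]x, y[%classic ->
  [/\ inf I <= sup I, I `<=` `]inf I, sup I]%classic &
      ((sup I - inf I)%:E <= mu I)%E].
Proof.
move=> oI iI I0 Ixy.
have hs : has_sup I.
  by split => //; exists y => z /Ixy; rewrite /= in_itv/= => /andP[_ /ltW].
have hi : has_inf I.
  by split => //; exists x => z /Ixy; rewrite /= in_itv/= => /andP[/ltW].
have lei z : I z -> inf I <= z by apply: ge_inf; exact: hi.2.
have les z : I z -> z <= sup I by apply: ub_le_sup; exact: hs.2.
have [z0 Iz0] := I0.
have le_is : inf I <= sup I by rewrite (le_trans (lei _ Iz0)) ?les.
split=> //.
  move=> z Iz; rewrite /= in_itv/= les // andbT lt_neqAle lei // andbT.
  (* An open set containing its infimum would contain points below it. *)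
  apply/negP => /eqP izE.
  have [e /= e0 Ie] := (@nbhs_ballP _ _ _ _).1 (open_nbhs_nbhs (conj oI Iz)).
  have /lei : I (z - e / 2).
    by apply: Ie; rewrite /ball /= opprB addrC subrK gtr0_norm; lra.
  by rewrite izE; lra.
have sub : `]inf I, sup I[%classic `<=` I.
  move=> z; rewrite /= in_itv/= => /andP[iz zs].
  have [u Iu uz] : exists2 u, I u & u < z.
    have iz0 : 0 < z - inf I by rewrite subr_gt0.
    by have [u Iu] := inf_adherent iz0 hi; rewrite subrKC; exists u.
  have [v Iv zv] : exists2 v, I v & z < v.
    have zs0 : 0 < sup I - z by rewrite subr_gt0.
    by have [v Iv] := sup_adherent zs0 hs; rewrite subKr; exists v.
  by apply: iI Iu Iv _ _; rewrite !ltW.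
apply: (@le_trans _ _ (mu `]inf I, sup I[%classic)).
  rewrite lebesgue_measure_itv /= lte_fin; case: ltP => //.
  by rewrite lee_fin subr_le0.
apply: le_measure => //; rewrite inE //=.
exact: open_measurable.
Qed.

(* The modulus bound makes the Stieltjes measure of F absolutely continuous: a
   null set lies in an open set of small measure, whose components are disjoint
   intervals. *)
Lemma monotone_density a b F : a < b ->
  {in `[a, b] &, nondecreasing_fun F} -> modulus_bound a b F ->
  exists2 h : R -> R, mu.-integrable [set: R] (EFin \o h) &
    {in `[a, b], forall x, F x - F a = \int[mu]_(t in `]a, x]) h t}.
Proof.
move=> ltab ndF modF; have ab := ltW ltab.
pose Fe x := F (clamp a b x).
have itvc x : clamp a b x \in `[a, b] by rewrite in_itv/= clamp_itv.
have ndFe : {homo Fe : x y / x <= y}.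
  by move=> x y xy; apply: ndF => //; exact: clamp_le.
(* Right continuity is the modulus bound for a list of one interval. *)
have rcFe x : Fe @ x^'+ --> Fe x.
  apply/cvgrPdist_le => e e0; have [dl dl0 hdl] := modF e e0.
  near=> y.
  have xy : x <= y by near: y; exact: nbhs_right_ge.
  rewrite distrC ger0_norm ?subr_ge0 ?ndFe //.
  have := hdl [:: (clamp a b x, clamp a b y)].
  rewrite /total_length !big_seq1; apply.
    rewrite /nonoverlapping /= clamp_le // !andbT.
    by have /andP[-> _] := clamp_itv x ab; have /andP[_ ->] := clamp_itv y ab.
  apply: (le_lt_trans (clamp_dist _ _ xy)); rewrite ltrBlDl.
  by near: y; apply: nbhs_right_lt; rewrite ltrDl.
pose G : cumulative R R := HB.pack Fe (isCumulative.Build R _ R Fe ndFe rcFe).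
pose D : set (measurableTypeR R) := `]a, b]%classic.
have mD : measurable D by exact: measurable_itv.
have Dfin : (lebesgue_stieltjes_measure G D < +oo)%E.
  by rewrite stieltjes_itv // ltry.
pose nu := [the {finite_measure set (measurableTypeR R) -> \bar R} of mfrestr mD Dfin].
have nuE A : nu A = lebesgue_stieltjes_measure G (A `&` D) by [].
have nu_itv x : x \in `[a, b] -> nu `]a, x]%classic = (F x - F a)%:E.
  rewrite in_itv/= => /andP[ax xb].
  rewrite nuE (_ : _ `&` D = `]a, x]%classic); last first.
    apply/seteqP; split => z /=; rewrite /D /= !in_itv/=; first by case.
    by move=> /andP[az zx]; rewrite az zx (le_trans zx).
  by rewrite stieltjes_itv //= /Fe !clamp_id ?lexx ?ab ?ax ?xb.
have dom : nu `<< mu.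
  apply/null_content_dominatesP => A mA muA0.
  apply/eqP; rewrite eq_le measure_ge0 andbT.
  apply/lee_addgt0Pr => e e0; rewrite add0e.
  have [dl dl0 hdl] := modF e e0.
  have [|U [oU AU UA]] := lebesgue_regularity_outer mA _ dl0.
    by rewrite muA0.
  (* Bounded, so that the components have finite endpoints; the margin keeps ]a, b] inside the open
     interval. *)
  pose V := U `&` `](a - 1), (b + 1)[%classic.
  have oV : open V by apply: openI => //; exact: itv_open.
  have mV : measurable V by exact: open_measurable.
  (* Regularity bounds the measure of U minus A, which is that of U because A is null. *)
  have Vdl : (mu V < dl%:E)%E.
    apply: le_lt_trans UA.
    rewrite -[leRHS]adde0 -muA0.
    have -> : (mu (U `\` A) + mu A = mu U)%E.
      rewrite addeC -[in RHS](setDUK AU) measureU //.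
        by apply: measurableD => //; exact: open_measurable.
      by rewrite setDIK.
    apply: le_measure => //; rewrite ?inE //; first exact: open_measurable.
    exact: subIsetl.
  pose I := open_disjoint_itv oV.
  have oI k : open (I k) by exact: open_disjoint_itv_open.
  have iI k : is_interval (I k) by exact: open_disjoint_itv_is_interval.
  have mI k : measurable (I k : set (measurableTypeR R)).
    exact: open_measurable (oI k).
  have IV : V = \bigcup_k I k by exact: open_disjoint_itv_bigcup.
  have Ixy k : I k `<=` `](a - 1), (b + 1)[%classic.
    move=> z Iz; have : V z by rewrite IV; exists k.
    by case.
  (* Endpoints of the k-th component, clamped to [a, b]; an empty component gets the trivial
     interval (a, a), since its [inf] and [sup] are meaningless. *)
  pose p k := if pselect (I k !=set0)
    then (clamp a b (inf (I k)), clamp a b (sup (I k))) else (a, a).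
  have pab k : [&& a <= (p k).1, (p k).1 <= (p k).2 & (p k).2 <= b].
    rewrite /p; case: pselect => [I0|_] /=; last by rewrite !lexx ab.
    have [le_is _ _] := open_interval_bounds (oI k) (iI k) I0 (@Ixy k).
    rewrite clamp_le //; have /andP[-> _] := clamp_itv (inf (I k)) ab.
    by have /andP[_ ->] := clamp_itv (sup (I k)) ab.
  have plen k : (((p k).2 - (p k).1)%:E <= mu (I k))%E.
    rewrite /p; case: pselect => [I0|_] /=; last by rewrite subrr measure_ge0.
    have [le_is _] := open_interval_bounds (oI k) (iI k) I0 (@Ixy k).
    by apply: le_trans; rewrite lee_fin clamp_dist.
  have pnu k : (nu (I k) <= (F (p k).2 - F (p k).1)%:E)%E.
    rewrite /p; case: pselect => [I0|In] /=; last first.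
      rewrite subrr nuE (_ : I k = set0) ?set0I ?measure0 //.
      by apply: contrapT => /eqP I0; apply: In; apply/set0P.
    have [le_is Iis _] := open_interval_bounds (oI k) (iI k) I0 (@Ixy k).
    have := @stieltjes_itv G _ _ le_is; rewrite /= -[F _]/(Fe _) -[F (clamp _ _ (inf _))]/(Fe _) => <-.
    rewrite nuE; apply: le_measure; rewrite ?inE //.
    + exact: measurableI.
    + by move=> z [/Iis].
  have psep j k : j != k -> itv_separated (p j) (p k).
    move=> jk; rewrite /itv_separated.
    have p0 l : ~ (I l !=set0) -> p l = (a, a) by rewrite /p; case: pselect.
    have [Ij|/p0 ->] := pselect (I j !=set0); last first.
      by have /and3P[-> _ _] := pab k.
    have [Ik|/p0 ->] := pselect (I k !=set0); last first.
      by have /and3P[-> _ _] := pab j; rewrite orbT.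
    have IJ0 : I j `&` I k = set0.
      have /trivIsetP := @open_disjoint_itv_trivIset _ _ oV.
      by apply.
    rewrite /p; case: pselect => // ?; case: pselect => // ? /=.
    have [h|h] := disjoint_intervals_sup_inf (iI j) (iI k) IJ0 Ij Ik.
      by rewrite clamp_le.
    by rewrite orbC clamp_le.
  have AV : A `&` D `<=` \bigcup_k I k.
    rewrite -IV => z [Az]; rewrite /D /= in_itv/= => /andP[az zb].
    split; first exact: AU.
    by rewrite /= in_itv/=; apply/andP; split; lra.
  have -> : nu A = nu (A `&` D) by rewrite !nuE -setIA setIid.
  apply: (le_trans (measure_sigma_subadditive nu mI (measurableI _ _ mA mD) AV)).
  apply: lime_le; first by apply: is_cvg_nneseries => n _ _; exact: measure_ge0.
  (* Each partial sum involves a finite nonoverlapping list of total length below [dl], to which the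
     modulus bound applies. *)
  apply: nearW => n.
  have -> : (\sum_(0 <= k < n) nu (I k) = \sum_(k <- iota 0 n) nu (I k))%E.
    by rewrite /index_iota subn0.
  apply: (@le_trans _ _ (\sum_(k <- iota 0 n) (F (p k).2 - F (p k).1)%:E)%E).
    by apply: lee_sum => k _; exact: pnu.
  rewrite sumEFin lee_fin -(big_map p predT (fun i => F i.2 - F i.1)) hdl //.
    apply/andP; split; first by apply/allP => _ /mapP[k _ ->]; exact: pab.
    rewrite pairwise_map; apply: sub_pairwise (_ : pairwise (fun j k => j != k) _).
      by move=> j k; exact: psep.
    by rewrite -uniq_pairwise iota_uniq.
  rewrite /total_length big_map -lte_fin -sumEFin (le_lt_trans _ Vdl) //.
  rewrite IV measure_semi_bigcup //; last 2 first.
  - exact: open_disjoint_itv_trivIset.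
  - exact: bigcup_measurable.
  apply: (@le_trans _ _ (\sum_(k <- iota 0 n) mu (I k))%E).
    by apply: lee_sum => k _; exact: plen.
  have -> : iota 0 n = index_iota 0 n by rewrite /index_iota subn0.
  exact: nneseries_lim_ge.
pose f := Radon_Nikodym_SigmaFinite.f nu mu.
have ffin x : f x \is a fin_num by exact: Radon_Nikodym_SigmaFinite.f_fin_num.
have fE : EFin \o (fine \o f) = f by apply/funext => x /=; rewrite fineK.
exists (fine \o f).
  by rewrite fE; exact: Radon_Nikodym_SigmaFinite.f_integrable.
move=> x xab; apply: EFin_inj; rewrite -nu_itv //.
rewrite (Radon_Nikodym_SigmaFinite.f_integral dom); last exact: measurable_itv.
rewrite /Rintegral; under [in RHS]eq_integral do rewrite /= fineK //.
have fi : mu.-integrable `]a, x] f.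
  apply: (@integrableS _ _ _ _ setT) => //.
  exact: Radon_Nikodym_SigmaFinite.f_integrable.
rewrite fineK //; exact: integrable_fin_num fi.
Unshelve. all: by end_near. Qed.

(** The density is the difference of the Radon-Nikodym densities of the two Jordan parts. Lebesgue's
    differentiation theorem, [FTC1], identifies it a.e. with the classical derivative. *)
Lemma absolutely_continuous_density a b (u : R -> R) : a < b ->
  absolutely_continuous a b u ->
  exists h : R -> R, [/\ mu.-integrable [set: R] (EFin \o h),
    {in `[a, b], forall x, u x - u a = \int[mu]_(t in `]a, x]) h t} &
    {ae mu, forall x, a < x < b -> derivable u x 1 /\ derive1 u x = h x}].
Proof.
move=> ab acu.
have [F1 [F2 [nd1 nd2 mod1 mod2 uE]]] := jordan_absolutely_continuous (ltW ab) acu.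
have [h1 ih1 F1E] := monotone_density ab nd1 mod1.
have [h2 ih2 F2E] := monotone_density ab nd2 mod2.
pose h t := h1 t - h2 t.
have ih : mu.-integrable [set: R] (EFin \o h).
  rewrite (_ : EFin \o h = ((EFin \o h1) \- (EFin \o h2))%E) //.
  exact: integrableB.
have itvS x : mu.-integrable `]a, x] (EFin \o h1) /\ mu.-integrable `]a, x] (EFin \o h2).
  by split; apply: (@integrableS _ _ _ _ setT).
have uh : {in `[a, b], forall x, u x - u a = \int[mu]_(t in `]a, x]) h t}.
  move=> x xab; have [i1 i2] := itvS x.
  rewrite RintegralB //.
  by rewrite -F1E // -F2E // !uE ?in_itv/= ?lexx ?(ltW ab) //; ring.
exists h; split => //.
have lh : locally_integrable [set: R] h.
  by have := integrable_locally measurableT ih; rewrite patch_setT.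
have ihy y : mu.-integrable [set` Interval (BRight a) (BRight y)] (EFin \o h).
  by apply: (@integrableS _ _ _ _ setT).
have := FTC1 ihy lh; apply: filterS; first exact: (ae_filter_ringOfSetsType mu).
move=> x dx /andP[ax xb]; have [dF F'] := dx ax.
(* The integral formula holds on [a, b] only, so derivatives can be compared only at interior
   points. *)
have near_u : {near x, (fun x => u a + \int[mu]_(t in `]a, x]) h t) =1 u}.
  have : x \in `]a, b[ by rewrite in_itv/= ax xb.
  move=> /near_in_itvoo; apply: filterS => y yab.
  by rewrite -(uh y) ?subrKC //; exact: subset_itv_oo_cc yab.
have dc : derivable (fun x => u a + \int[mu]_(t in `]a, x]) h t) x 1.
  by apply: derivableD => //; exact: derivable_cst.
split; first exact: near_eq_derivable near_u dc.
rewrite derive1E -(near_eq_derive _ near_u) deriveD //.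
by rewrite derive_cst add0r -derive1E.
Qed.

End density.

(** * Measure-preserving maps *)

Section measure_preserving.
Context d (T : measurableType d) {R : realType}.
Variable mu : {measure set T -> \bar R}.
Implicit Types (q : \bar R) (f g : T -> R).

Lemma ae_imp (P Q : T -> Prop) : (forall x, P x -> Q x) ->
  {ae mu, forall x, P x} -> {ae mu, forall x, Q x}.
Proof.
move=> PQ [N [mN N0 NP]]; exists N; split => // x /= nQ.
by apply: NP => /= Px; apply: nQ; exact: PQ.
Qed.

Lemma ae_imp2 (P Q S : T -> Prop) : (forall x, P x -> Q x -> S x) ->
  {ae mu, forall x, P x} -> {ae mu, forall x, Q x} -> {ae mu, forall x, S x}.
Proof.
move=> PQS [N [mN N0 NP]] [M [mM M0 MQ]]; exists (N `|` M); split.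
- exact: measurableU.
- exact: null_set_setU.
- move=> x /= nS; have [Px|nPx] := pselect (P x); last by left; exact: NP.
  by right; apply: MQ => /= Qx; exact/nS/PQS.
Qed.

Lemma mem_LfunP f q : f \in Lfun mu q <->
  measurable_fun setT f /\ ('N[mu]_q[EFin \o f] < +oo)%E.
Proof.
rewrite inE; split => [/andP[]|[mf ff]]; first by rewrite !inE.
by apply/andP; rewrite !inE.
Qed.

Lemma Lnorm_le q f g : (1 <= q)%E -> measurable_fun setT f -> measurable_fun setT g ->
  (forall x, `|f x| <= `|g x|) -> ('N[mu]_q[EFin \o f] <= 'N[mu]_q[EFin \o g])%E.
Proof.
move=> q1 mf mg fg; rewrite unlock.
have mpow (h : T -> R) r : measurable_fun setT h ->
    measurable_fun setT (fun x => (`|(EFin \o h) x| `^ r)%E).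
  move=> mh; apply/(@measurableT_comp _ _ _ _ _ _ (fun x => x `^ r)%E) => //.
    exact: measurable_poweR.
  by apply: measurableT_comp => //; exact/measurable_EFinP.
case: q q1 => [r r1| _|//].
- have r0 : 0 <= r by rewrite (le_trans ler01).
  apply: gt0_ler_poweR; rewrite ?invr_ge0 //.
  + by rewrite in_itv/= leey integral_ge0.
  + by rewrite in_itv/= leey integral_ge0.
  + apply: ge0_le_integral => //.
    * by move=> x _; exact: poweR_ge0.
    * exact: (mpow f r mf).
    * exact: (mpow g r mg).
    * move=> x _; rewrite /= lee_fin ge0_ler_powR ?nnegrE //.
- case: ifP => // mu0; apply: le_ess_sup; apply: aeW => x /=.
  by rewrite lee_fin.
Qed.

Lemma Lfun_le q f g : (1 <= q)%E -> measurable_fun setT f -> g \in Lfun mu q ->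
  (forall x, `|f x| <= `|g x|) -> f \in Lfun mu q.
Proof.
move=> q1 mf /mem_LfunP[mg fg] le_fg; apply/mem_LfunP; split => //.
exact: le_lt_trans (Lnorm_le q1 mf mg le_fg) fg.
Qed.

Definition measure_preserving (phi : T -> T) := measurable_fun setT phi /\
  forall A, measurable A -> mu (phi @^-1` A) = mu A.

Variable phi : T -> T.
Hypothesis mp : measure_preserving phi.

Lemma measure_preserving_ae (P : T -> Prop) :
  {ae mu, forall x, P x} -> {ae mu, forall x, P (phi x)}.
Proof.
move=> [N [mN N0 PN]]; have [mphi muphi] := mp; exists (phi @^-1` N); split.
- by rewrite -[X in measurable X]setTI; exact: mphi.
- by rewrite muphi.
- by move=> x /= Px; apply: PN.
Qed.

Lemma ge0_integral_measure_preserving (F : T -> \bar R) :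
  measurable_fun setT F -> (forall x, 0 <= F x)%E ->
  (\int[mu]_x F (phi x) = \int[mu]_x F x)%E.
Proof.
move=> mF F0; have [mphi muphi] := mp.
have F0' : {in [set: T], forall y, 0 <= F y}%E by move=> y _; exact: F0.
rewrite -[LHS](ge0_integral_pushforward mphi mu measurableT mF F0').
by apply: eq_measure_integral => A mA _; exact: muphi.
Qed.

Lemma integral_measure_preserving (F : T -> \bar R) :
  measurable_fun setT F -> (\int[mu]_x F (phi x) = \int[mu]_x F x)%E.
Proof.
move=> mF; rewrite integralE [RHS]integralE.
rewrite -(ge0_integral_measure_preserving (measurable_funepos mF)) //.
rewrite -(ge0_integral_measure_preserving (measurable_funeneg mF)) //.
by congr (_ - _)%E; apply: eq_integral => x _; rewrite ?funeposE ?funenegE.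
Qed.

Lemma Lnorm_measure_preserving q f : (1 <= q)%E -> measurable_fun setT f ->
  ('N[mu]_q[EFin \o (f \o phi)] <= 'N[mu]_q[EFin \o f])%E.
Proof.
move=> q1 mf; rewrite unlock; case: q q1 => [r r1| _|//].
  have mF : measurable_fun setT (fun x => (`|(f x)%:E| `^ r)%E).
    apply/(@measurableT_comp _ _ _ _ _ _ (fun x => x `^ r)%E) => //.
      exact: measurable_poweR.
    by apply: measurableT_comp => //; exact/measurable_EFinP.
  rewrite -(ge0_integral_measure_preserving mF (fun x => poweR_ge0 _ _)).
  exact: lexx.
case: ifP => // mu0; apply/ess_supP.
exact: (measure_preserving_ae (ess_sup_ge mu (abse \o (EFin \o f)))).
Qed.

Lemma Lfun_measure_preserving q f : (1 <= q)%E -> f \in Lfun mu q ->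
  f \o phi \in Lfun mu q.
Proof.
move=> q1 /mem_LfunP[mf ff]; have [mphi _] := mp; apply/mem_LfunP; split.
  exact: measurableT_comp.
exact: le_lt_trans (Lnorm_measure_preserving q1 mf) ff.
Qed.

End measure_preserving.

(** Lebesgue measure is determined by its values on half-open intervals, and a reflected interval
    differs only in which endpoint it contains. *)
Lemma measure_preserving_oppr (R : realType) :
  measure_preserving (@lebesgue_measure R) (fun x => - x).
Proof.
have mN : measurable_fun [set: measurableTypeR R] (fun x => - x : measurableTypeR R).
  exact: oppr_measurable.
split => // A mA; apply/esym.
apply: (lebesgue_measure_unique (mu := pushforward (@lebesgue_measure R)
  (fun x => - x : measurableTypeR R))) => //.
move=> X /ocitvP[->|[[a b] /= ab ->]]; first by rewrite !measure0.
rewrite /pushforward (_ : _ @^-1` _ = `[(- b), (- a)[%classic); last first.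
  by apply/seteqP; split => x; rewrite /= !in_itv/= (ltrNr a) (lerNl x) andbC.
by rewrite !lebesgue_measure_itv /= !lte_fin ltrN2 ab opprK addeC.
Qed.

(** * The Taylor formula with integral remainder *)

Section taylor_kernel.
Context {R : realType}.
Local Notation mu := (@lebesgue_measure R).
Implicit Types (j : nat) (s t y : R).

(** The kernel of (j + 1)-fold integration from 0 to t. Being zero unless 0 <= y <= t, it allows all
    integrals to be taken over the whole line. *)
Definition taylor_kernel j t y : R :=
  if (0 <= y) && (y <= t) then (t - y) ^+ j / j`!%:R else 0.

Lemma taylor_kernel_ge0 j t y : 0 <= taylor_kernel j t y.
Proof.
rewrite /taylor_kernel; case: ifP => // /andP[_ yt].
by rewrite divr_ge0 // exprn_ge0 // subr_ge0.
Qed.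

Lemma measurable_taylor_kernel j : measurable_fun [set: measurableTypeR R * measurableTypeR R]
  (fun z => taylor_kernel j z.1 z.2).
Proof.
apply: measurable_fun_ifT => //.
  by apply: measurable_and; apply: measurable_fun_ler.
apply: measurable_funM => //; apply: measurable_funX.
by apply: measurable_funB; [exact: measurable_fst|exact: measurable_snd].
Qed.

Lemma measurable_taylor_kernelr j t : measurable_fun [set: measurableTypeR R] (taylor_kernel j t).
Proof. exact: (measurableT_comp (measurable_taylor_kernel j) (measurable_pair1 t)). Qed.

Lemma measurable_taylor_kernell j y :
  measurable_fun [set: measurableTypeR R] (fun t => taylor_kernel j t y).
Proof. exact: (measurableT_comp (measurable_taylor_kernel j) (measurable_pair2 y)). Qed.

Lemma integral_taylor_kernel j t y :
  (\int[mu]_(s in `[0%R, t]) (taylor_kernel j s y)%:E = (taylor_kernel j.+1 t y)%:E)%E.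
Proof.
have [yt|] := boolP ((0 <= y) && (y < t)); last first.
  move=> nyt; have -> : taylor_kernel j.+1 t y = 0.
    rewrite /taylor_kernel; case: ifP => // /andP[y0 yt].
    move: nyt; rewrite y0 /= -leNgt => ty.
    by rewrite (_ : t = y) ?subrr ?expr0n ?mul0r //; apply/eqP; rewrite eq_le ty.
  (* Dropping the endpoint matters: for y = t and j = 0 the kernel is 1 at s = t. *)
  rewrite -(@integral_itv_bndo_bndc _ _ t); last first.
    apply/measurable_EFinP/measurable_funTS. exact: (measurable_taylor_kernell j y).
  apply: integral0_eq => s; rewrite /= in_itv/= => /andP[s0 st].
  rewrite /taylor_kernel; case: ifP => // /andP[y0 ys].
  by move: nyt; rewrite y0 /= (le_lt_trans ys st).
have /andP[y0 lt_yt] := yt.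
rewrite {2}/taylor_kernel y0 (ltW lt_yt) /=.
pose F : R -> R := (j.+1`!%:R)^-1 *: ((id - cst y) ^+ j.+1).
have FE s : F s = (s - y) ^+ j.+1 / j.+1`!%:R.
  by rewrite /F fctE; exact: mulrC.
have dF (s : R) : is_derive s 1 F ((s - y) ^+ j / j`!%:R).
  rewrite /F; apply: is_derive_eq.
  rewrite subr0 /GRing.scale /= mulr1 factS natrM invfM.
  by rewrite mulrACA mulVf ?mul1r ?pnatr_eq0 // mulrC.
have := @continuous_FTC2 R (fun s => (s - y) ^+ j / j`!%:R) F y t lt_yt.
have -> : (\int[mu]_(s in `[0%R, t]) (taylor_kernel j s y)%:E =
           \int[mu]_(s in `[y, t]) ((s - y) ^+ j / j`!%:R)%:E)%E.
  rewrite integral_mkcond [RHS]integral_mkcond; apply: eq_integral => s _.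
  rewrite !patchE !mem_setE !in_itv/= /taylor_kernel y0 /=.
  case: ifPn => [/andP[s0 ->]|]; rewrite ?andbT; first by case: ifP.
  by case: ifPn => // /andP[ys ->]; rewrite (le_trans y0 ys).
rewrite !FE subrr expr0n mul0r sube0; apply.
- apply: continuous_subspaceT => s.
  apply: cvgM; last exact: cvg_cst.
  apply: (@continuous_comp _ _ _ (fun s => s - y) (fun x => x ^+ j)).
    by apply: cvgB; [exact: cvg_id|exact: cvg_cst].
  exact: exprn_continuous.
- have cF s : {for s, continuous F}.
    by apply: differentiable_continuous; apply/derivable1_diffP; exact: ex_derive.
  split; first by move=> s _; exact: ex_derive.
    exact/cvg_at_right_filter/cF.
  exact/cvg_at_left_filter/cF.
- by move=> s _; rewrite derive1E derive_val.
Qed.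

Lemma taylor_kernel_le j t y B : t <= B -> 0 <= B ->
  taylor_kernel j t y <= B ^+ j / j`!%:R.
Proof.
move=> tB B0; rewrite /taylor_kernel; case: ifP => [/andP[y0 yt]|_].
  rewrite ler_pM2r ?invr_gt0 ?ltr0n ?fact_gt0 // lerXn2r ?nnegrE ?subr_ge0 //.
  by lra.
by rewrite divr_ge0 // exprn_ge0.
Qed.

(** The kernel with the restriction of its first variable to [0, t] built in, so that Fubini and
    Tonelli apply on the full product. *)
Definition taylor_segment j t (z : measurableTypeR R * measurableTypeR R) : R :=
  if (0 <= z.1) && (z.1 <= t) then taylor_kernel j z.1 z.2 else 0.

Lemma measurable_taylor_segment j t : measurable_fun setT (taylor_segment j t).
Proof.
apply: measurable_fun_ifT => //; last exact: measurable_taylor_kernel.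
by apply: measurable_and; apply: measurable_fun_ler.
Qed.

Lemma taylor_segment_ge0 j t z : 0 <= taylor_segment j t z.
Proof. by rewrite /taylor_segment; case: ifP => // _; exact: taylor_kernel_ge0. Qed.

Lemma integral_taylor_segment j t y :
  (\int[mu]_s (taylor_segment j t (s, y))%:E = (taylor_kernel j.+1 t y)%:E)%E.
Proof.
rewrite -integral_taylor_kernel [RHS]integral_mkcond; apply: eq_integral => s _.
by rewrite patchE mem_setE in_itv/= /taylor_segment /=; case: ifP.
Qed.

Lemma integral_segment_patch (f : R -> \bar R) t :
  (\int[mu]_(s in `[0%R, t]) f s =
   \int[mu]_s (if (0 <= s)%R && (s <= t)%R then f s else 0))%E.
Proof.
rewrite integral_mkcond; apply: eq_integral => s _.
by rewrite patchE mem_setE in_itv.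
Qed.

(** Cauchy's formula for repeated integration: one use of Tonelli per integral raises the degree of
    the kernel by one. *)
Lemma iterated_integralE r (h : R -> \bar R) t :
  measurable_fun [set: measurableTypeR R] h -> (forall y, 0 <= h y)%E ->
  iterated_integral r.+1 h t = (\int[mu]_y ((taylor_kernel r t y)%:E * h y))%E.
Proof.
move=> mh h0; elim: r t => [|r ih] t.
  rewrite /= integral_segment_patch; apply: eq_integral => y _.
  rewrite /taylor_kernel expr0 fact0 divr1; case: ifP => _; first by rewrite mul1e.
  by rewrite mul0e.
rewrite -[LHS]/(\int[mu]_(y in `[0%R, t]) iterated_integral r.+1 h y)%E.
rewrite integral_segment_patch.
under eq_integral do rewrite ih.
transitivity (\int[mu]_s \int[mu]_y ((taylor_segment r t (s, y))%:E * h y))%E.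
  apply: eq_integral => s _; rewrite /taylor_segment /=; case: ifP => // _.
  by under [RHS]eq_integral do rewrite mul0e; rewrite integral0.
rewrite (fubini_tonelli (fun z => (taylor_segment r t z)%:E * h z.2)%E).
- apply: eq_integral => y _ /=; rewrite ge0_integralZr //.
  + by rewrite integral_taylor_segment.
  + apply/measurable_EFinP; apply: measurable_fun_pair1.
    exact: measurable_taylor_segment.
  + by move=> s _; rewrite lee_fin taylor_segment_ge0.
- apply: emeasurable_funM; last exact: measurableT_comp.
  by apply/measurable_EFinP; exact: measurable_taylor_segment.
- by move=> z; rewrite mule_ge0 ?lee_fin ?taylor_segment_ge0.
Qed.

Lemma integrable_taylor_kernel j t (g : R -> R) :
  mu.-integrable [set: R] (EFin \o g) ->
  mu.-integrable [set: R] (fun y => (taylor_kernel j t y * g y)%:E).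
Proof.
move=> ig; have [t0|t0] := ltP t 0.
  have -> : (fun y => (taylor_kernel j t y * g y)%:E) = cst 0%E.
    apply/funext => y; rewrite /taylor_kernel; case: ifP => [/andP[y0 yt]|_].
      by have := le_trans y0 yt; rewrite leNgt t0.
    by rewrite mul0r.
  exact: integrable0.
have mg : measurable_fun [set: measurableTypeR R] g.
  by apply/measurable_EFinP; have /integrableP[] := ig.
have igt := integrableZl measurableT (t ^+ j / j`!%:R) ig.
apply: le_integrable igt => //.
- apply/measurable_EFinP; apply: measurable_funM => //.
  exact: measurable_taylor_kernelr.
- move=> y _; rewrite -EFinM !abse_EFin lee_fin [leRHS]normrM [leLHS]normrM ler_wpM2r //.
  rewrite ger0_norm ?taylor_kernel_ge0 // (le_trans (@taylor_kernel_le j t y t _ _)) //.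
  exact: ler_norm.
Qed.

Lemma integral_taylor_step j t (g : R -> R) :
  mu.-integrable [set: R] (EFin \o g) ->
  (\int[mu]_(s in `[0%R, t]) \int[mu]_y (taylor_kernel j s y * g y)%:E =
   \int[mu]_y (taylor_kernel j.+1 t y * g y)%:E)%E.
Proof.
move=> ig; rewrite integral_segment_patch.
have mg : measurable_fun [set: measurableTypeR R] g.
  by apply/measurable_EFinP; have /integrableP[] := ig.
pose f (z : measurableTypeR R * measurableTypeR R) := (taylor_segment j t z * g z.2)%:E.
have mf : measurable_fun setT f.
  apply/measurable_EFinP; apply: measurable_funM.
    exact: measurable_taylor_segment.
  exact: measurableT_comp.
transitivity (\int[mu]_s \int[mu]_y f (s, y))%E.
  apply: eq_integral => s _; rewrite /f /taylor_segment /=; case: ifP => // _.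
  by under [RHS]eq_integral do rewrite mul0r; rewrite integral0.
rewrite Fubini.
  apply: eq_integral => y _; rewrite /f /=.
  under eq_integral do rewrite EFinM.
  rewrite integralZr //; first by rewrite integral_taylor_segment.
  apply/integrableP; split.
    by apply/measurable_EFinP; apply: measurable_fun_pair1; exact: measurable_taylor_segment.
  under eq_integral do rewrite abse_EFin ger0_norm ?taylor_segment_ge0 //.
  by rewrite integral_taylor_segment ltry.
(* Integrability on the product is tested by integrating in [s] first: this gives the kernel of
   degree j + 1 times |g|, which is integrable. *)
apply/integrable21ltyP => //.
apply: (@le_lt_trans _ _ (\int[mu]_y `|taylor_kernel j.+1 t y * g y|%:E)%E).
  apply: ge0_le_integral => //.
  - by move=> y _; exact: integral_ge0.
  - apply: (@measurable_fun_fubini_tonelli_G _ _ _ _ _ mu (abse \o f)) => //.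
    exact: measurableT_comp.
    by move=> z; exact: abse_ge0.
  - apply/measurable_EFinP; apply: measurableT_comp => //; apply: measurable_funM => //.
    exact: measurable_taylor_kernelr.
  - move=> y _.
    rewrite [leLHS](_ : _ = \int[mu]_s ((taylor_segment j t (s, y))%:E * `|g y|%:E))%E; last first.
      apply: eq_integral => s _.
      by rewrite /= normrM EFinM ger0_norm ?taylor_segment_ge0.
    rewrite ge0_integralZr //.
    + by rewrite integral_taylor_segment -EFinM normrM ger0_norm ?taylor_kernel_ge0.
    + by apply/measurable_EFinP; apply: measurable_fun_pair1; exact: measurable_taylor_segment.
    + by move=> s _; rewrite lee_fin taylor_segment_ge0.
by have /integrableP[_] := integrable_taylor_kernel j.+1 t ig.
Qed.

End taylor_kernel.

(** * Taylor's formula for functions in W_{0,q}^r(R) *)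

Section sobolev_taylor.
Context {R : realType}.
Local Notation mu := (@lebesgue_measure R).
Implicit Types (f g : R -> R).

Lemma absolutely_continuous_continuous f :
  (forall a b, absolutely_continuous a b f) -> continuous f.
Proof.
move=> acf x; apply/cvgrPdist_lt => e e0.
have [dl dl0 H] := absolutely_continuous_seq (acf (x - 1) (x + 1)) e0.
have small (u v : R) : x - 1 <= u -> u <= v -> v <= x + 1 -> v - u < dl -> `|f v - f u| < e.
  move=> xu uv vx vudl; have := H [:: (u, v)].
  rewrite /nonoverlapping /total_length /total_oscillation !big_seq1 /= xu uv vx.
  exact.
near=> y.
have /ltW xy1 : `|x - y| < 1 by near: y; apply: cvgr_dist_lt.
have xydl : `|x - y| < dl by near: y; apply: cvgr_dist_lt.
have [xy|/ltW yx] := leP x y.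
  rewrite distrC; apply: small => //.
  - by rewrite gerBl.
  - by rewrite -lerBlDl; apply: le_trans xy1; rewrite distrC ler_norm.
  - by apply: le_lt_trans xydl; rewrite distrC ler_norm.
apply: small => //.
- by rewrite lerBlDl -lerBlDr; apply: le_trans xy1; rewrite ler_norm.
- by rewrite lerDl.
- by apply: le_lt_trans xydl; rewrite ler_norm.
Unshelve. all: by end_near. Qed.

Lemma sobolev0_continuous r q f j : sobolev0 r.+1 q f -> (j <= r)%N ->
  continuous (derive1n j f).
Proof.
move=> [_ df acf _]; rewrite leq_eqVlt => /orP[/eqP ->|jr].
  exact: absolutely_continuous_continuous.
move=> x; apply: differentiable_continuous; apply/derivable1_diffP.
exact: df.
Qed.

(** [absolutely_continuous_density] speaks of bounded intervals; countably many of them exhaust the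
    line. *)
Lemma sobolev0_derivable_ae r q f : sobolev0 r.+1 q f ->
  {ae mu, forall x, derivable (derive1n r f) x 1}.
Proof.
move=> [_ _ acf _].
have H n : {ae mu, forall x, - n.+1%:R < x < n.+1%:R -> derivable (derive1n r f) x 1}.
  have nn : - n.+1%:R < n.+1%:R :> R by rewrite gtrN ?ltr0n.
  have [h [_ _]] := absolutely_continuous_density nn (acf _ _).
  by apply: ae_imp => x H /H[].
have /ae_foralln := H; apply: ae_imp => x Hx; apply: (Hx (Num.bound `|x|)).
rewrite -ltr_norml (lt_le_trans (archi_boundP (normr_ge0 x))) //.
by rewrite ler_nat leqnSn.
Qed.

(** The density of [f] is a.e. its derivative, hence a.e. equal to [g] on ]0, B[. Junk values of
    [derive1] and the endpoints form null sets. *)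
Lemma absolutely_continuous_integral f g B : 0 < B ->
  absolutely_continuous 0 B f -> f 0 = 0 ->
  measurable_fun [set: R] g -> {ae mu, forall x, derive1 f x = g x} ->
  mu.-integrable `[0, B] (EFin \o g) /\
  forall x, 0 <= x <= B -> (f x)%:E = (\int[mu]_(t in `[0%R, x]) (g t)%:E)%E.
Proof.
move=> B0 acf f0 mg f'g.
have [h [ih fh dh]] := absolutely_continuous_density B0 acf.
have gh : {ae mu, forall x, 0 < x < B -> g x = h x}.
  by apply: ae_imp2 f'g dh => x <- H /H[].
have mgS (D : set R) : measurable_fun D g by exact: measurable_funTS mg.
have ghS (D : set R) : D `<=` `]0, B[ -> ae_eq mu D (EFin \o g) (EFin \o h).
  move=> DB; apply: ae_imp gh => x H /DB /=; rewrite in_itv/= => /H.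
  by move=> ->.
have mh : measurable_fun [set: R] h.
  by apply/measurable_EFinP; have /integrableP[] := ih.
have mabs (k : R -> R) (D : set R) : measurable_fun [set: R] k ->
    measurable_fun D (abse \o (EFin \o k)).
  by move=> mk; apply: measurable_funTS; apply: measurableT_comp => //; exact/measurable_EFinP.
split.
  apply/integrableP; split; first by apply/measurable_EFinP; exact: mgS.
  rewrite integral_itv_bndoo; last exact: mabs.
  rewrite (@ae_eq_integral _ _ _ mu `]0, B[ (fun x => `|(EFin \o h) x|%E)) //.
  - have : mu.-integrable `]0, B[ (EFin \o h) by exact: integrableS ih.
    by move=> /integrableP[].
  - exact: mabs.
  - exact: mabs.
  - by apply: ae_imp (ghS _ (@subset_refl _ _)) => x H /H /= [->].
move=> x /andP[x0 xB].
have := fh x; rewrite in_itv/= x0 xB f0 subr0 => -> //.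
rewrite /Rintegral fineK; last first.
  by apply: integrable_fin_num => //; exact: integrableS ih.
rewrite [LHS]integral_itv_bndoo; last by apply/measurable_EFinP; exact: measurable_funTS mh.
rewrite [RHS]integral_itv_bndoo; last by apply/measurable_EFinP; exact: mgS.
apply/esym; apply: ae_eq_integral => //.
- by apply/measurable_EFinP; exact: mgS.
- apply/measurable_EFinP; exact: measurable_funTS mh.
- by apply: ghS => y /=; rewrite !in_itv/= => /andP[-> /lt_le_trans ->].
Qed.

Lemma sobolev0_taylor r q f g : sobolev0 r.+1 q f ->
  measurable_fun [set: R] g -> {ae mu, forall x, derive1n r.+1 f x = g x} ->
  forall x, 0 <= x ->
  mu.-integrable [set: R] (fun y => (taylor_kernel r x y * g y)%:E) /\
  (f x)%:E = (\int[mu]_y (taylor_kernel r x y * g y)%:E)%E.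
Proof.
move=> sf mg fg x x0.
(* The shift by 1 keeps the interval nondegenerate when x = 0. *)
pose B := x + 1; have B0 : 0 < B by rewrite /B; lra.
have [f0 df acf _] := sf.
have [ig uE] := absolutely_continuous_integral B0 (acf 0 B) (f0 r (ltnSn r)) mg fg.
(* Integrability of [g] is available on [0, B] only; a kernel with t <= B does not see the
   truncation. *)
pose g1 y := if (0 <= y) && (y <= B) then g y else 0.
have ig1 : mu.-integrable [set: R] (EFin \o g1).
  rewrite (_ : EFin \o g1 = (EFin \o g) \_ `[0, B]); last first.
    by apply/funext => y; rewrite patchE mem_setE in_itv/= /g1; case: ifP.
  have mI : measurable (`[0, B]%classic : set (measurableTypeR R)) by exact: measurable_itv.
  exact: (@integrable_mkcond _ _ _ mu _ (EFin \o g) mI).1.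
have Kg j t y : t <= B -> taylor_kernel j t y * g y = taylor_kernel j t y * g1 y.
  move=> tB; rewrite /taylor_kernel /g1; case: ifP => [/andP[-> yt]|]; last by rewrite !mul0r.
  by rewrite (le_trans yt tB).
(* Downwards from the derivative of order r, which is an integral by absolute continuity; the lower
   ones are C^1 and vanish at 0, so the ordinary fundamental theorem applies. *)
have H j : (j <= r)%N -> forall t, 0 <= t <= B ->
    (derive1n (r - j) f t)%:E = (\int[mu]_y (taylor_kernel j t y * g1 y)%:E)%E.
  elim: j => [|j ih] jr t /andP[t0 tB].
    rewrite subn0 uE ?t0 // integral_segment_patch; apply: eq_integral => y _.
    by rewrite -Kg // /taylor_kernel expr0 fact0 divr1; case: ifP; rewrite ?mul1r ?mul0r.
  rewrite -integral_taylor_step //.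
  have rj : (r - j = (r - j.+1).+1)%N by rewrite subnSK.
  have vf : (r - j.+1 <= r)%N by rewrite leq_subr.
  have v0 : derive1n (r - j.+1) f 0 = 0 by apply: f0; rewrite ltnS leq_subr.
  have [<-|tne0] := eqVneq 0 t.
    rewrite v0 (_ : `[0, 0]%classic = [set 0]) ?integral_set1 //.
    by apply/seteqP; split => z; rewrite /= in_itv/=; [move/le_anti|move=> ->; rewrite lexx].
  have lt0t : 0 < t by rewrite lt_neqAle tne0.
  have := @continuous_FTC2 R (derive1n (r - j) f) (derive1n (r - j.+1) f) 0 t lt0t.
  rewrite v0 sube0 => <-.
  - apply: eq_integral => s; rewrite inE/= in_itv/= => /andP[s0 st].
    by rewrite ih ?s0 ?(ltnW jr) // (le_trans st).
  - apply: continuous_subspaceT; apply: (sobolev0_continuous sf); exact: leq_subr.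
  - have cv := sobolev0_continuous sf vf.
    split.
    + by move=> s _; apply: df; rewrite ltnS -rj leq_subr.
    + exact/cvg_at_right_filter/cv.
    + exact/cvg_at_left_filter/cv.
  - by move=> s _; rewrite rj.
have xB : x <= B by rewrite /B; lra.
split.
  have := integrable_taylor_kernel r x ig1.
  by apply: eq_integrable => // y _; rewrite Kg.
have := H r (leqnn r) x; rewrite subnn x0 xB => -> //.
by apply: eq_integral => y _; rewrite Kg.
Qed.

End sobolev_taylor.

(** * Reflections and restrictions to a half-line *)

Section sobolev_symmetries.
Context {R : realType}.
Local Notation mu := (@lebesgue_measure R).
Implicit Types (f g w : R -> R) (b : bool).

Lemma derive1_nonderivable w x : ~ derivable w x 1 -> derive1 w x = 0.
Proof. by move=> /dvgP; rewrite derive1E. Qed.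

(** Carrying the chain-rule sign along makes differentiation send [sign_opp n] to
    [sign_opp n.+1]. *)
Definition sign_opp n w : R -> R := fun t => (-1) ^+ n * w (- t).

Lemma sign_oppK n w : sign_opp n (sign_opp n w) = w.
Proof.
apply/funext => t; rewrite /sign_opp opprK mulrA -exprMn mulrNN mulr1 expr1n.
by rewrite mul1r.
Qed.

Lemma is_derive_sign_opp n w x : derivable w (- x) 1 ->
  is_derive x 1 (sign_opp n w) ((-1) ^+ n.+1 * derive1 w (- x)).
Proof.
move=> dw; have dw' : is_derive (- x) 1 w (derive1 w (- x)).
  by rewrite derive1E; apply/derivableP.
have dN : is_derive x 1 (fun t : R => - t) (- 1).
  by apply: is_derive_eq.
have dc := @is_derive1_comp _ w (fun t => - t) x _ _ dw' dN.
have -> : sign_opp n w = (-1) ^+ n *: (w \o (fun t => - t)) by [].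
by apply: is_derive_eq; rewrite /GRing.scale /= exprS mulN1r mulrN1 mulrN mulNr.
Qed.

(** This holds at every point: since [sign_opp n] is an involution, both sides fail to be
    derivatives simultaneously and then take the default value 0. *)
Lemma derive1_sign_opp n w : derive1 (sign_opp n w) = sign_opp n.+1 (derive1 w).
Proof.
apply/funext => x; have [dw|ndw] := pselect (derivable w (- x) 1).
  by rewrite derive1E; have [_ ->] := is_derive_sign_opp n dw.
rewrite /sign_opp (derive1_nonderivable ndw) mulr0; apply: derive1_nonderivable => dw.
apply: ndw; rewrite -[w](sign_oppK n).
have dw' : derivable (sign_opp n w) (- - x) 1 by rewrite opprK.
by have [] := is_derive_sign_opp n dw'.
Qed.

Lemma derive1n_opp j f : derive1n j (fun t => f (- t)) = sign_opp j (derive1n j f).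
Proof.
elim: j => [|j ih]; first by apply/funext => t; rewrite /sign_opp expr0 mul1r.
by rewrite !derive1nS ih derive1_sign_opp.
Qed.

Lemma absolutely_continuous_sign_opp n w :
  (forall a c, absolutely_continuous a c w) ->
  forall a c, absolutely_continuous a c (sign_opp n w).
Proof.
move=> acw a c e e0; have [dl dl0 H] := acw (- c) (- a) e e0.
exists dl => // m u v uv sep len.
have := H m (fun i => - v i) (fun i => - u i).
have -> : \sum_i (- u i - - v i) = \sum_i (v i - u i).
  by apply: eq_bigr => i _; rewrite opprK addrC.
have -> : \sum_i `|w (- u i) - w (- v i)| = \sum_i `|sign_opp n w (v i) - sign_opp n w (u i)|.
  apply: eq_bigr => i _; rewrite /sign_opp -mulrBr normrM normrX normrN normr1 expr1n mul1r.
  exact: distrC.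
apply => // [i|i j ij]; first by have [? ? ?] := uv i; rewrite !lerN2.
by rewrite !lerN2; have [h|h] := sep i j ij; [right|left].
Qed.

Lemma measurable_sign_opp n w : measurable_fun [set: R] w ->
  measurable_fun [set: R] (sign_opp n w).
Proof.
move=> mw; apply: measurable_funM => //.
by apply: measurableT_comp => //; exact: oppr_measurable.
Qed.

Lemma sobolev0_opp r q f g : (1 <= q)%E -> sobolev0 r.+1 q f ->
  Lq_representative mu q (derive1n r.+1 f) g ->
  sobolev0 r.+1 q (fun t => f (- t)) /\
  Lq_representative mu q (derive1n r.+1 (fun t => f (- t))) (sign_opp r.+1 g).
Proof.
move=> q1 [f0 df acf _] [Lg fg].
have rep : Lq_representative mu q (derive1n r.+1 (fun t => f (- t))) (sign_opp r.+1 g).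
  split.
    have [mg _] := (mem_LfunP _ _ _).1 Lg.
    apply: (Lfun_le q1 _ (Lfun_measure_preserving (measure_preserving_oppr R) q1 Lg)).
      exact: measurable_sign_opp.
    by move=> x; rewrite /sign_opp normrM normrX normrN1 expr1n mul1r.
  rewrite derive1n_opp.
  have := measure_preserving_ae (measure_preserving_oppr R) fg.
  by apply: ae_imp => x; rewrite /sign_opp => ->.
split => //; split.
- by move=> j jr; rewrite derive1n_opp /sign_opp oppr0 f0 ?mulr0.
- move=> j x jr; rewrite derive1n_opp.
  by have [] := is_derive_sign_opp j (df j (- x) jr).
- by rewrite derive1n_opp; exact: absolutely_continuous_sign_opp.
- by exists (sign_opp r.+1 g).
Qed.

(** [b] is true for the negative half-line; 0 belongs to the other one, the convention of
    [orthant]. *)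
Definition half_line b w : R -> R := fun t => if (t < 0) == b then w t else 0.

Lemma near_half_line b w (x : R) : x != 0 ->
  {near x, half_line b w =1 (if (x < 0) == b then w else cst 0)}.
Proof.
move=> x0; apply/nbhs_ballP; exists `|x|; rewrite /= ?normr_gt0 // => y.
rewrite /ball /= => xy; have -> : (x < 0) = (y < 0).
  have [xneg|xpos|/eqP] := ltgtP x 0; last by rewrite (negbTE x0).
    apply/esym; move: xy; rewrite (ltr0_norm xneg) distrC => /(le_lt_trans (ler_norm _)).
    by rewrite ltrBlDl subrr.
  apply/esym/negbTE; rewrite -leNgt.
  move: xy; rewrite (gtr0_norm xpos) => /(le_lt_trans (ler_norm _)).
  by rewrite ltrBlDr ltrDl => /ltW.
by rewrite /half_line; case: ifP.
Qed.

Lemma derive1_half_line_neq0 b w (x : R) : x != 0 ->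
  derive1 (half_line b w) x = half_line b (derive1 w) x.
Proof.
move=> x0; rewrite derive1E (near_eq_derive _ (near_half_line b w x0)) /half_line.
by case: ifP => _; rewrite -derive1E // derive1_cst.
Qed.

(** At 0 each difference quotient of the cut function is either 0 or that of [w], which tends to 0.
    Elsewhere the sign is locally constant. *)
Lemma is_derive_half_line b w (x : R) : (forall x, derivable w x 1) -> w 0 = 0 -> derive1 w 0 = 0 ->
  is_derive x 1 (half_line b w) (half_line b (derive1 w) x).
Proof.
move=> dw w0 dw0; have [->|x0] := eqVneq x 0; last first.
  rewrite -derive1_half_line_neq0 // derive1E; apply/derivableP.
  apply: (near_eq_derivable (f := if (x < 0) == b then w else cst 0)).
    by have := near_half_line b w x0; apply: filterS => y ->.
  by case: ifP => _; [exact: dw|exact: derivable_cst].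
have half_line0 : half_line b (derive1 w) 0 = 0 by rewrite /half_line dw0 if_same.
have lim : h^-1 *: ((half_line b w \o shift 0) (h *: 1) - half_line b w 0) @[h --> 0^'] --> (0 : R).
  have wlim : h^-1 *: ((w \o shift 0) (h *: 1) - w 0) @[h --> 0^'] --> (0 : R).
    have : _ --> 'D_1 w 0 := dw 0.
    by rewrite -derive1E dw0.
  apply/cvgrPdist_lt => e e0; move/cvgrPdist_lt : wlim => /(_ e e0).
  apply: filterS => h; apply: le_lt_trans.
  rewrite !sub0r !normrN /half_line /= w0 if_same.
  by case: ifP => // _; rewrite subrr scaler0 normr0.
rewrite half_line0; split; first by apply/cvg_ex; exists 0.
exact/cvg_lim.
Qed.

Lemma derive1n_half_line b j f : (forall i x, (i < j)%N -> derivable (derive1n i f) x 1) ->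
  (forall i, (i <= j)%N -> derive1n i f 0 = 0) ->
  derive1n j (half_line b f) = half_line b (derive1n j f).
Proof.
elim: j => [//|j ih] df f0.
rewrite !derive1nS ih => [|i x ij|i ij]; [|by apply: df; apply: ltnW|by apply: f0; apply: leqW].
apply/funext => x; rewrite derive1E.
by have [|||_ ->] := @is_derive_half_line b (derive1n j f) x;
  [move=> y; exact: df|exact: f0|rewrite -derive1nS f0|].
Qed.

Lemma absolutely_continuous_half_line b w : w 0 = 0 ->
  (forall a c, absolutely_continuous a c w) ->
  forall a c, absolutely_continuous a c (half_line b w).
Proof.
move=> w0 acw a c e e0.
(* Since w 0 = 0, cutting is composition with the projection onto the half-line, which is monotone
   and 1-Lipschitz. *)
pose k t : R := if b then Num.min t 0 else Num.max t 0.
have wk t : half_line b w t = w (k t).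
  rewrite /half_line /k; case: (b); rewrite /Num.min /Num.max; case: ltP => //=; rewrite ?w0.
have k_le s t : s <= t -> k s <= k t.
  rewrite /k => st; case: (b); rewrite /Num.min /Num.max;
    by case: (ltP s 0) => ?; case: (ltP t 0) => ? //; lra.
have k_dist s t : s <= t -> k t - k s <= t - s.
  rewrite /k => st; case: (b); rewrite /Num.min /Num.max;
    by case: (ltP s 0) => ?; case: (ltP t 0) => ? //; lra.
have [dl dl0 H] := acw (k a) (k c) e e0.
exists dl => // m u v uv sep len.
under eq_bigr do rewrite !wk.
apply: (H m (fun i => k (u i)) (fun i => k (v i))).
- by move=> i; have [? ? ?] := uv i; split; exact: k_le.
- by move=> i j ij; have [h|h] := sep i j ij; [left|right]; exact: k_le.
- apply: le_lt_trans len; apply: ler_sum => i _; apply: k_dist.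
  by have [] := uv i.
Qed.

Lemma measurable_half_line b w : measurable_fun [set: R] w ->
  measurable_fun [set: R] (half_line b w).
Proof.
move=> mw; apply: measurable_fun_ifT => //.
have -> : (fun t : R => (t < 0) == b) = (if b then fun t => t < 0 else fun t => 0 <= t).
  by apply/funext => t; case: b; rewrite ?eqb_id // eqbF_neg -leNgt.
by case: b; [exact: measurable_fun_ltr|exact: measurable_fun_ler].
Qed.

Lemma sobolev0_half_line b r q f g : (1 <= q)%E -> sobolev0 r.+1 q f ->
  Lq_representative mu q (derive1n r.+1 f) g ->
  sobolev0 r.+1 q (half_line b f) /\
  Lq_representative mu q (derive1n r.+1 (half_line b f)) (half_line b g).
Proof.
move=> q1 [f0 df acf _] [Lg fg].
have halfE j : (j <= r)%N -> derive1n j (half_line b f) = half_line b (derive1n j f).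
  move=> jr; apply: derive1n_half_line => [i x ij|i ij].
    by apply: df; rewrite ltnS (leq_trans ij).
  by apply: f0; rewrite ltnS (leq_trans ij).
have rep : Lq_representative mu q (derive1n r.+1 (half_line b f)) (half_line b g).
  split.
    have [mg _] := (mem_LfunP _ _ _).1 Lg.
    apply: (Lfun_le q1 _ Lg); first exact: measurable_half_line.
    by move=> x; rewrite /half_line; case: ifP; rewrite ?normr0.
  (* At 0 the cut may create a corner in the derivative of order r, so the next order is compared
     off this null set. *)
  have n0 : {ae mu, forall x, x != 0}.
    exists [set 0]; split; [exact: measurable_set1|exact: lebesgue_measure_set1|].
    by move=> x /= /negP; rewrite negbK => /eqP.
  apply: ae_imp2 fg n0 => x fg x0; rewrite derive1nS halfE // derive1_half_line_neq0 //.
  by rewrite /half_line -derive1nS fg.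
split => //; split.
- by move=> j jr; rewrite halfE // /half_line f0 // if_same.
- move=> j x jr; rewrite halfE 1?ltnW //.
  have [] // := @is_derive_half_line b (derive1n j f) x.
  + by move=> y; exact: df.
  + by rewrite f0 // ltnW.
  + by rewrite -derive1nS f0.
- by rewrite halfE //; apply: absolutely_continuous_half_line => //; rewrite f0.
- by exists (half_line b g).
Qed.

End sobolev_symmetries.

(** * Integration on R^d *)

Section integration_Rn.
Context {R : realType}.
Local Notation mu := (@lebesgue_measure R).
Implicit Types (d : nat).

Lemma measurable_coord d (i : 'I_d) :
  measurable_fun [set: Rn R d] (fun x => tnth x i : measurableTypeR R).
Proof. exact: measurable_tnth. Qed.

Lemma measurable_prod_coord d (phi : 'I_d -> R -> R) :
  (forall i, measurable_fun [set: R] (phi i)) ->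
  measurable_fun [set: Rn R d] (fun x => \prod_(i < d) phi i (tnth x i)).
Proof.
move=> mphi; apply: measurable_prod => i _.
exact: (measurableT_comp (mphi i) (measurable_coord i)).
Qed.

Lemma measurable_Rn_cons d : measurable_fun setT (@Rn_cons R d).
Proof. exact: measurable_cons. Qed.

Lemma ge0_integral_Rn_rec d (F : Rn R d.+1 -> \bar R) :
  measurable_fun setT F -> (forall x, 0 <= F x)%E ->
  (\int[lebesgue_Rn R d.+1]_x F x =
   \int[mu]_y \int[lebesgue_Rn R d]_t F (Rn_cons (y, t)))%E.
Proof.
move=> mF F0.
have F0' : {in [set: Rn R d.+1], forall y, 0 <= F y}%E by move=> y _; exact: F0.
rewrite [LHS](ge0_integral_pushforward (@measurable_Rn_cons d) _ measurableT mF F0').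
rewrite preimage_setT (fubini_tonelli1 (F \o Rn_cons)) //.
  exact: (measurableT_comp mF (@measurable_Rn_cons d)).
by move=> x; exact: F0.
Qed.

Lemma integral_Rn_rec d (F : Rn R d.+1 -> \bar R) :
  (lebesgue_Rn R d.+1).-integrable setT F ->
  (\int[lebesgue_Rn R d.+1]_x F x =
   \int[mu]_y \int[lebesgue_Rn R d]_t F (Rn_cons (y, t)))%E.
Proof.
move=> iF; have /integrableP[mF _] := iF.
have iFc : (mu \x lebesgue_Rn R d)%E.-integrable setT (F \o Rn_cons).
  apply/integrableP; split; first exact: (measurableT_comp mF (@measurable_Rn_cons d)).
  have /integrableP[_] := iF.
  have mabs : measurable_fun setT (abse \o F) by exact: measurableT_comp.
  have abs0 : {in [set: Rn R d.+1], forall y, 0 <= (abse \o F) y}%E.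
    by move=> y _; exact: abse_ge0.
  apply: le_lt_trans.
  have E := ge0_integral_pushforward (@measurable_Rn_cons d) (mu \x lebesgue_Rn R d)%E measurableT mabs abs0.
  by rewrite preimage_setT in E; rewrite -[leLHS]E.
have := integral_pushforward (@measurable_Rn_cons d) mF iFc measurableT.
by rewrite preimage_setT -(integral12_prod_meas1 iFc).
Qed.

Lemma integral_Rn0 (F : Rn R 0 -> \bar R) :
  (\int[lebesgue_Rn R 0]_x F x = F [tuple])%E.
Proof.
rewrite (_ : F = cst (F [tuple])); last by apply/funext => x; rewrite [x]tuple0.
by rewrite integral_cst //= diracT mule1.
Qed.

Lemma prod_Rn_cons d (phi : 'I_d.+1 -> R -> R) y t :
  \prod_(i < d.+1) phi i (tnth (Rn_cons (y, t)) i) =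
  phi ord0 y * \prod_(i < d) phi (lift ord0 i) (tnth t i).
Proof.
rewrite big_ord_recl /Rn_cons tnth0; congr (_ * _).
by apply: eq_bigr => i _; rewrite tnthS.
Qed.

Lemma ge0_integral_prod_coord d (phi : 'I_d -> R -> R) :
  (forall i, measurable_fun [set: R] (phi i)) -> (forall i x, 0 <= phi i x) ->
  (\int[lebesgue_Rn R d]_x (\prod_(i < d) phi i (tnth x i))%:E =
   \prod_(i < d) \int[mu]_y (phi i y)%:E)%E.
Proof.
elim: d phi => [|d ih] phi mphi phi0.
  by rewrite integral_Rn0 !big_ord0.
rewrite ge0_integral_Rn_rec; last 2 first.
- by apply/measurable_EFinP; exact: measurable_prod_coord.
- by move=> x; rewrite lee_fin prodr_ge0.
rewrite big_ord_recl -ih //.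
rewrite -ge0_integralZr //; last 3 first.
- by apply/measurable_EFinP; exact: mphi.
- by move=> x _; rewrite lee_fin.
- by apply: integral_ge0 => x _; rewrite lee_fin prodr_ge0.
apply: eq_integral => y _.
under eq_integral do rewrite prod_Rn_cons EFinM.
rewrite ge0_integralZl_EFin //; first by move=> x _; rewrite lee_fin prodr_ge0.
by apply/measurable_EFinP; exact: (measurable_prod_coord (fun i => mphi (lift ord0 i))).
Qed.

Lemma integrable_prod_coord d (phi : 'I_d -> R -> R) :
  (forall i, mu.-integrable setT (EFin \o phi i)) ->
  (lebesgue_Rn R d).-integrable setT (fun x => (\prod_(i < d) phi i (tnth x i))%:E).
Proof.
move=> iphi.
have mphi i : measurable_fun [set: R] (phi i).
  by apply/measurable_EFinP; have /integrableP[] := iphi i.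
apply/integrableP; split; first by apply/measurable_EFinP; exact: measurable_prod_coord.
under eq_integral do rewrite abse_EFin normr_prod.
rewrite (@ge0_integral_prod_coord d (fun i y => `|phi i y|)) //; last first.
  by move=> i; exact: measurableT_comp.
rewrite ltey_eq prode_fin_num // => i _.
have /integrableP[_ fin] := iphi i.
by rewrite ge0_fin_numE //; exact: integral_ge0.
Qed.

Lemma integral_prod_coord d (phi : 'I_d -> R -> R) :
  (forall i, mu.-integrable setT (EFin \o phi i)) ->
  (\int[lebesgue_Rn R d]_x (\prod_(i < d) phi i (tnth x i))%:E =
   (\prod_(i < d) \int[mu]_y phi i y)%:E)%E.
Proof.
elim: d phi => [|d ih] phi iphi.
  by rewrite integral_Rn0 !big_ord0.
rewrite integral_Rn_rec; last exact: integrable_prod_coord.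
rewrite big_ord_recl EFinM -ih //.
rewrite [in RHS]/Rintegral fineK; last exact: (integrable_fin_num measurableT (iphi ord0)).
have ii := integrable_prod_coord (fun i => iphi (lift ord0 i)).
rewrite -(fineK (integrable_fin_num measurableT ii)) // -integralZr //; last exact: iphi.
apply: eq_integral => y _.
under [LHS]eq_integral do rewrite prod_Rn_cons EFinM.
by rewrite integralZl // fineK //; exact: (integrable_fin_num measurableT ii).
Qed.

Lemma ae_coord d (P : 'I_d -> R -> Prop) :
  (forall i, {ae mu, forall y, P i y}) ->
  {ae lebesgue_Rn R d, forall x, forall i, P i (tnth x i)}.
Proof.
move=> aeP.
have H i : {ae lebesgue_Rn R d, forall x, P i (tnth x i)}.
  have [N [mN N0 PN]] := aeP i.
  exists [set x | N (tnth x i)]; split.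
  - rewrite -[X in measurable X]setTI; exact: (measurable_coord i).
  (* The cylinder over N is a box with one null side, and 0 * +oo = 0 absorbs the infinite sides. *)
  - pose A j : set (measurableTypeR R) := if j == i then N else setT.
    rewrite (_ : [set x | _] = [set x | forall j, A j (tnth x j)]).
      rewrite lebesgue_Rn_box; last by move=> j; rewrite /A; case: ifP.
      by rewrite (bigD1 i) //= /A eqxx [X in (X * _)%E]N0 mul0e.
    apply/seteqP; split => x /=; first by move=> Nx j; rewrite /A; case: eqP => [->|].
    by move=> /(_ i); rewrite /A eqxx.
  - by move=> x /= Px; apply: PN.
(* Coordinates are coded as naturals, in order to use a countable conjunction of a.e. statements. *)
have : {ae lebesgue_Rn R d, forall x n, if insub n is Some i then P i (tnth x i) else True}.
  apply: ae_foralln => n; case: insubP => [i _ _|_]; first exact: H.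
  by apply: aeW.
by apply: ae_imp => x + i => /(_ (val i)); rewrite valK.
Qed.

Definition flip d (b : 'I_d -> bool) (x : Rn R d) : Rn R d :=
  [tuple if b i then - tnth x i else tnth x i | i < d].

Lemma tnth_flip d b (x : Rn R d) i : tnth (flip b x) i = if b i then - tnth x i else tnth x i.
Proof. by rewrite tnth_mktuple. Qed.

Lemma flip_cons d (b : 'I_d.+1 -> bool) y (t : Rn R d) :
  flip b (Rn_cons (y, t)) =
  Rn_cons (if b ord0 then - y else y, flip (fun i => b (lift ord0 i)) t).
Proof.
apply: eq_from_tnth => i; rewrite tnth_flip /Rn_cons.
by case: (unliftP ord0 i) => [j ->|->]; rewrite ?tnthS ?tnth0 ?tnth_flip.
Qed.

Lemma measurable_flip d (b : 'I_d -> bool) : measurable_fun setT (flip b).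
Proof.
apply/measurable_fun_tnthP => i; rewrite (_ : _ \o _ = fun x => if b i then - tnth x i else tnth x i).
  case: (b i); last exact: measurable_coord.
  by apply: measurableT_comp (measurable_coord i); exact: oppr_measurable.
by apply/funext => x; rewrite /= tnth_flip.
Qed.

(** By Tonelli the first coordinate is split off; it is reflected or left alone, and induction
    handles the others. *)
Lemma ge0_integral_flip d (b : 'I_d -> bool) (F : Rn R d -> \bar R) :
  measurable_fun setT F -> (forall x, 0 <= F x)%E ->
  (\int[lebesgue_Rn R d]_x F (flip b x) = \int[lebesgue_Rn R d]_x F x)%E.
Proof.
elim: d b F => [|d ih] b F mF F0.
  by rewrite !integral_Rn0; congr F; exact: tuple0.
rewrite !ge0_integral_Rn_rec //; last exact: (measurableT_comp mF (@measurable_flip _ b)).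
have mFc : measurable_fun setT (F \o @Rn_cons R d).
  exact: (measurableT_comp mF (@measurable_Rn_cons d)).
pose G y := (\int[lebesgue_Rn R d]_t F (Rn_cons (y, t)))%E.
have mG : measurable_fun [set: measurableTypeR R] G.
  apply: (@measurable_fun_fubini_tonelli_F _ _ _ _ _ (lebesgue_Rn R d)
    (F \o @Rn_cons R d)) => //; by move=> z; exact: F0.
transitivity (\int[mu]_y G (if b ord0 then (- y)%R else y))%E.
  apply: eq_integral => y _; rewrite /G.
  rewrite -[RHS](ih (fun i => b (lift ord0 i))) //; last exact: (measurable_fun_pair2 _ mFc).
  by apply: eq_integral => t _; rewrite flip_cons.
case: (b ord0); last exact: erefl.
rewrite (ge0_integral_measure_preserving (measure_preserving_oppr R) mG) // => y.
exact: integral_ge0.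
Qed.

Lemma measure_preserving_flip d (b : 'I_d -> bool) :
  measure_preserving (lebesgue_Rn R d) (flip b).
Proof.
split; first exact: measurable_flip.
move=> A mA.
have mfA : measurable (flip b @^-1` A) by rewrite -[X in measurable X]setTI; exact: measurable_flip.
have E B : measurable B ->
    lebesgue_Rn R d B = (\int[lebesgue_Rn R d]_x (\1_B x)%:E)%E.
  by move=> mB; rewrite integral_indic // setIT.
apply: (etrans (E _ mfA)); apply: etrans (esym (E _ mA)).
rewrite -[RHS](ge0_integral_flip b); last 2 first.
- by apply/measurable_EFinP; exact: measurable_indic.
- by move=> x; rewrite lee_fin.
by apply: eq_integral => x _; rewrite !indicE.
Qed.

End integration_Rn.

(** * Mixed derivatives and orthants *)

Section mixed_derivatives.
Context {R : realType}.
Local Notation mu := (@lebesgue_measure R).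

Lemma is_derive_lincomb n (c : 'I_n -> R) (g : 'I_n -> R -> R) (t : R) :
  (forall k, derivable (g k) t 1) ->
  is_derive t 1 (fun s => \sum_k c k * g k s) (\sum_k c k * derive1 (g k) t).
Proof.
move=> dg; have dcg k : is_derive t 1 (c k *: g k) (c k * derive1 (g k) t).
  have dgk : is_derive t 1 (g k) (derive1 (g k) t) by rewrite derive1E; exact/derivableP.
  exact: is_deriveZ.
have -> : (fun s => \sum_k c k * g k s) = \sum_k (c k *: g k).
  by apply/funext => s; rewrite fct_sumE.
exact: is_derive_sum.
Qed.

Lemma derive1n_lincomb n (c : 'I_n -> R) (g : 'I_n -> R -> R) j :
  (forall k i x, (i < j)%N -> derivable (derive1n i (g k)) x 1) ->
  derive1n j (fun s => \sum_k c k * g k s) = (fun s => \sum_k c k * derive1n j (g k) s).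
Proof.
elim: j => [//|j ih] dg; rewrite derive1nS ih; last by move=> k i x ij; apply: dg; exact: ltnW.
apply/funext => s; rewrite derive1E.
by have [_ ->] := is_derive_lincomb c (fun k => dg k j s (ltnSn j)).
Qed.

Variables (d r n : nat) (q : \bar R) (g : 'I_n -> 'I_d -> R -> R).
Hypothesis sg : forall k j, sobolev0 r.+1 q (g k j).

Let f (x : Rn R d) := \sum_(k < n) \prod_(j < d) g k j (tnth x j).

Lemma tnth_set_coord (x : Rn R d) i t j :
  tnth (set_coord x i t) j = if j == i then t else tnth x j.
Proof. by rewrite /set_coord tnth_mktuple. Qed.

(** Along a coordinate line the tensor is a linear combination of one-variable functions.
    Derivatives up to order r exist everywhere, so only the last differentiation needs a hypothesis,
    and only at the coordinates of [x]. *)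
Lemma foldr_partial_derivative (s : seq 'I_d) (x : Rn R d) : uniq s ->
  (forall i k, i \in s -> derivable (derive1n r (g k i)) (tnth x i) 1) ->
  foldr (partial_derivative r.+1) f s x =
  \sum_(k < n) \prod_(j < d)
    (if j \in s then derive1n r.+1 (g k j) else g k j) (tnth x j).
Proof.
elim: s x => [//|i s ih] x /= /andP[nis us] dx.
rewrite /partial_derivative.
pose c k := \prod_(j < d | j != i)
  (if j \in s then derive1n r.+1 (g k j) else g k j) (tnth x j).
have -> : (fun t => foldr (partial_derivative r.+1) f s (set_coord x i t)) =
    (fun t => \sum_k c k * g k i t).
  (* Only coordinate [i] moves, and it is not in [s]: the derivability hypotheses persist along the
     whole line. *)
  apply/funext => t; rewrite ih //; last first.
    move=> j k js; rewrite tnth_set_coord; case: eqP => [ji|_].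
      by rewrite -ji js in nis.
    by apply: dx; rewrite inE js orbT.
  apply: eq_bigr => k _; rewrite (bigD1 i) //= tnth_set_coord eqxx (negbTE nis) mulrC.
  congr (_ * _); apply: eq_bigr => j ji; rewrite tnth_set_coord (negbTE ji).
  by [].
rewrite derive1nS derive1n_lincomb; last first.
  by move=> k j y jr; have [_ df _ _] := sg k i; exact: df.
rewrite derive1E; have [_ ->] := is_derive_lincomb c (fun k => dx i k (mem_head i s)).
apply: eq_bigr => k _; rewrite [RHS](bigD1 i) //= mem_head mulrC; congr (_ * _).
by apply: eq_bigr => j ji; rewrite in_cons (negbTE ji).
Qed.

Lemma mixed_derivative_tensor_ae (h : 'I_n -> 'I_d -> R -> R) :
  (forall k j, {ae mu, forall t, derive1n r.+1 (g k j) t = h k j t}) ->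
  {ae lebesgue_Rn R d, forall x, mixed_derivative r.+1 f x =
     \sum_(k < n) \prod_(j < d) h k j (tnth x j)}.
Proof.
move=> gh.
have H (i : 'I_d) (k : 'I_n) : {ae mu, forall t,
    derivable (derive1n r (g k i)) t 1 /\ derive1n r.+1 (g k i) t = h k i t}.
  exact: ae_imp2 (sobolev0_derivable_ae (sg k i)) (gh k i).
have Hi (i : 'I_d) : {ae mu, forall t, forall k,
    derivable (derive1n r (g k i)) t 1 /\ derive1n r.+1 (g k i) t = h k i t}.
  have : {ae mu, forall t m, if insub m is Some k then
    derivable (derive1n r (g k i)) t 1 /\ derive1n r.+1 (g k i) t = h k i t else True}.
    apply: ae_foralln => m; case: insubP => [k _ _|_]; first exact: H.
    by apply: aeW.
  by apply: ae_imp => t + k => /(_ (val k)); rewrite valK.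
have := ae_coord Hi; apply: ae_imp => x Hx.
rewrite /mixed_derivative foldr_partial_derivative ?enum_uniq //; last first.
  by move=> i k _; have [] := Hx i k.
apply: eq_bigr => k _; apply: eq_bigr => j _; rewrite mem_enum.
by have [] := Hx j k.
Qed.

End mixed_derivatives.

(** * Cutting tensors along orthants *)

Section orthants.
Context {R : realType}.
Variable d : nat.
Local Notation mu := (@lebesgue_measure R).
Implicit Types (b : 'I_d -> bool) (S : {set {ffun 'I_d -> bool}}) (x : Rn R d).

Definition orthant x : {ffun 'I_d -> bool} := [ffun i => tnth x i < 0].

Definition fold_orthants b S (f : Rn R d -> R) : Rn R d -> R :=
  fun x => (orthant x \in S)%:R * f (flip b x).

(** The indicator of an orthant is a product over coordinates, so cutting to one orthant keeps
    elementary tensors elementary. *)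
Lemma prod_half_line (s : {ffun 'I_d -> bool}) (u : 'I_d -> R -> R) x :
  \prod_(j < d) half_line (s j) (u j) (tnth x j) =
  (orthant x == s)%:R * \prod_(j < d) u j (tnth x j).
Proof.
have [<-|ne] := eqVneq.
  rewrite mul1r; apply: eq_bigr => j _.
  by rewrite /half_line /orthant ffunE eqxx.
rewrite mul0r; have [j /negbTE xj] : exists j, (tnth x j < 0) != s j.
  apply/existsP; apply: contraR ne => /existsPn ne.
  by apply/eqP/ffunP => j; rewrite ffunE; apply/eqP; rewrite -[_ == _]negbK.
by rewrite (bigD1 j) //= /half_line xj mul0r.
Qed.

(** One term per pair of an orthant in S and a term of the tensor; the pairs are enumerated because
    [algebraic_tensor] asks for an ordinal index. *)
Lemma sum_prod_half_line S n (u : 'I_n -> 'I_d -> R -> R) x :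
  let A := [pred p : {ffun 'I_d -> bool} * 'I_n | p.1 \in S] in
  \sum_(k < #|A|) \prod_(j < d)
    half_line ((enum_val k).1 j) (u (enum_val k).2 j) (tnth x j) =
  (orthant x \in S)%:R * \sum_(k < n) \prod_(j < d) u k j (tnth x j).
Proof.
move=> A.
rewrite -(@big_enum_val _ _ _ _ A (fun p : {ffun 'I_d -> bool} * 'I_n =>
  \prod_(j < d) half_line (p.1 j) (u p.2 j) (tnth x j))) /=.
rewrite (eq_bigl (fun p => (p.1 \in S) && true)); last by move=> p; rewrite !inE andbT.
rewrite -(pair_big (fun s => s \in S) xpredT
  (fun (s : {ffun 'I_d -> bool}) k => \prod_(j < d) half_line (s j) (u k j) (tnth x j))) /=.
rewrite (eq_bigr (fun s : {ffun 'I_d -> bool} =>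
  (orthant x == s)%:R * \sum_(k < n) \prod_(j < d) u k j (tnth x j))); last first.
  by move=> s _; rewrite mulr_sumr; apply: eq_bigr => k _; exact: prod_half_line.
rewrite -mulr_suml; congr (_ * _).
have [xS|xS] := boolP (orthant x \in S).
  rewrite (bigD1 (orthant x)) //= eqxx big1 ?addr0 // => s /andP[_ /negbTE].
  by rewrite eq_sym => ->.
by rewrite big1 // => s sS; case: eqP => // xs; rewrite xs sS in xS.
Qed.

(** The indicator is the cut of the constant 1, seen as a single elementary tensor. *)
Lemma measurable_orthant S : measurable_fun [set: Rn R d] (fun x => (orthant x \in S)%:R : R).
Proof.
rewrite (_ : (fun x => _) = fun x => \sum_(k < #|[pred p : {ffun 'I_d -> bool} * 'I_1 | p.1 \in S]|)
    \prod_(j < d) half_line ((enum_val k).1 j) (cst 1) (tnth x j)); last first.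
  apply/funext => x; rewrite (sum_prod_half_line S (fun _ _ => cst 1)).
  by rewrite big_ord1 big1 ?mulr1.
apply: measurable_sum => k.
apply: (measurable_prod_coord (phi := fun j => half_line _ (cst 1))) => j.
exact: measurable_half_line.
Qed.

Lemma measurable_fold_orthants b S f : measurable_fun setT f ->
  measurable_fun setT (fold_orthants b S f).
Proof.
move=> mf; apply: measurable_funM; first exact: measurable_orthant.
exact: (measurableT_comp mf (@measurable_flip _ _ b)).
Qed.

Lemma fold_orthants_le b S f x : `|fold_orthants b S f x| <= `|f (flip b x)|.
Proof.
rewrite /fold_orthants; case: (_ \in _); first by rewrite mul1r.
by rewrite mul0r normr0.
Qed.

End orthants.

(** * Folding preserves the unit ball *)

Section fold_unit_ball.
Context {R : realType}.
Variables (d r : nat) (q : \bar R).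
Hypothesis q1 : (1 <= q)%E.
Local Notation mu := (@lebesgue_measure R).
Local Notation mud := (lebesgue_Rn R d).
Variables (b : 'I_d -> bool) (S : {set {ffun 'I_d -> bool}}).
Implicit Types (f G : Rn R d -> R).

(** The chain-rule sign: each reflected coordinate is differentiated r + 1 times. *)
Definition flip_sign : R := \prod_(j < d) (if b j then (-1) ^+ r.+1 else 1).

Definition fold_derivative G : Rn R d -> R := fun x => flip_sign * fold_orthants b S G x.

Lemma norm_flip_sign : `|flip_sign| = 1.
Proof.
rewrite normr_prod big1 // => j _.
by case: (b j); rewrite ?normr1 // normrX normrN1 expr1n.
Qed.

Lemma measurable_fold_derivative G : measurable_fun setT G ->
  measurable_fun setT (fold_derivative G).
Proof. by move=> mG; apply: measurable_funM => //; exact: measurable_fold_orthants. Qed.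

Lemma fold_derivative_le G x : `|fold_derivative G x| <= `|(G \o flip b) x|.
Proof. by rewrite /fold_derivative normrM norm_flip_sign mul1r fold_orthants_le. Qed.

Lemma Lnorm_fold_derivative G : measurable_fun setT G ->
  ('N[mud]_q[EFin \o fold_derivative G] <= 'N[mud]_q[EFin \o G])%E.
Proof.
move=> mG; have mp := @measure_preserving_flip R d b.
apply: le_trans (Lnorm_measure_preserving mp q1 mG).
apply: Lnorm_le => //; first exact: measurable_fold_derivative.
  exact: (measurableT_comp mG (@measurable_flip _ _ b)).
exact: fold_derivative_le.
Qed.

Lemma Lfun_fold_derivative G : G \in Lfun mud q -> fold_derivative G \in Lfun mud q.
Proof.
move=> /mem_LfunP[mG fG]; apply/mem_LfunP; split; first exact: measurable_fold_derivative.
exact: le_lt_trans (Lnorm_fold_derivative mG) fG.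
Qed.

(** Folding acts factor by factor: reflect where [b] says so, then restrict to half-lines. Both
    operations preserve the one-dimensional space. *)
Lemma fold_orthants_tensor f G : algebraic_tensor r.+1 q f ->
  Lq_representative mud q (mixed_derivative r.+1 f) G ->
  algebraic_tensor r.+1 q (fold_orthants b S f) /\
  Lq_representative mud q (mixed_derivative r.+1 (fold_orthants b S f)) (fold_derivative G).
Proof.
move=> [n [g [sg ->]]] [LG fG].
have /choice[h0 gh0] : forall p : 'I_n * 'I_d, exists h : R -> R,
    Lq_representative mu q (derive1n r.+1 (g p.1 p.2)) h.
  by move=> p; have [] := sg p.1 p.2.
pose h k j := h0 (k, j).
have gh k j : Lq_representative mu q (derive1n r.+1 (g k j)) (h k j) by exact: (gh0 (k, j)).
pose g1 k j : R -> R := if b j then (fun t => g k j (- t)) else g k j.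
pose h1 k j : R -> R := if b j then sign_opp r.+1 (h k j) else h k j.
have gh1 k j : sobolev0 r.+1 q (g1 k j) /\
    Lq_representative mu q (derive1n r.+1 (g1 k j)) (h1 k j).
  rewrite /g1 /h1; case: (b j) => //; exact: sobolev0_opp.
pose A := [pred p : {ffun 'I_d -> bool} * 'I_n | p.1 \in S].
pose g2 (k : 'I_#|A|) j := half_line ((enum_val k).1 j) (g1 (enum_val k).2 j).
pose h2 (k : 'I_#|A|) j := half_line ((enum_val k).1 j) (h1 (enum_val k).2 j).
have gh2 k j : sobolev0 r.+1 q (g2 k j) /\
    Lq_representative mu q (derive1n r.+1 (g2 k j)) (h2 k j).
  by have [s1 l1] := gh1 (enum_val k).2 j; exact: sobolev0_half_line.
have fE : fold_orthants b S (fun x => \sum_(k < n) \prod_(j < d) g k j (tnth x j)) =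
    (fun x => \sum_(k < #|A|) \prod_(j < d) g2 k j (tnth x j)).
  apply/funext => x; rewrite (sum_prod_half_line S g1) /fold_orthants; congr (_ * _).
  apply: eq_bigr => k _; apply: eq_bigr => j _.
  by rewrite tnth_flip /g1; case: (b j).
split; first by exists #|A|, g2; split => // k j; have [] := gh2 k j.
split; first exact: Lfun_fold_derivative.
have M1 := mixed_derivative_tensor_ae sg (fun k j => (gh k j).2).
have M2 := mixed_derivative_tensor_ae (fun k j => (gh2 k j).1) (fun k j => (gh2 k j).2.2).
(* [G] and the tensor built from the chosen [h] represent the same mixed derivative, hence agree
   a.e.; [M4] moves this to reflected points. *)
have M3 : {ae mud, forall x, G x = \sum_(k < n) \prod_(j < d) h k j (tnth x j)}.
  by apply: ae_imp2 fG M1 => x <-.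
have M4 := measure_preserving_ae (@measure_preserving_flip R d b) M3.
rewrite fE; apply: ae_imp2 M2 M4 => x -> Gx.
rewrite (sum_prod_half_line S h1) /fold_derivative /fold_orthants Gx mulrCA; congr (_ * _).
rewrite mulr_sumr; apply: eq_bigr => k _; rewrite /flip_sign -big_split /=.
apply: eq_bigr => j _; rewrite tnth_flip /h1 /sign_opp.
by case: (b j); rewrite ?mul1r.
Qed.

(** Folding is linear and does not increase the norm, so it carries the approximating sequence and
    its convergence along. *)
Lemma fold_orthants_unit_ball f : tensor_unit_ball r.+1 q f ->
  tensor_unit_ball r.+1 q (fold_orthants b S f).
Proof.
move=> [G [LG [f_ [G_ [af rG cvf cvG]]]] G1].
have [mG _] := (mem_LfunP _ _ _).1 LG.
exists (fold_derivative G); last exact: le_trans (Lnorm_fold_derivative mG) G1.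
split; first exact: Lfun_fold_derivative.
exists (fun n => fold_orthants b S (f_ n)), (fun n => fold_derivative (G_ n)); split.
- by move=> n; have [] := fold_orthants_tensor (af n) (rG n).
- by move=> n; have [] := fold_orthants_tensor (af n) (rG n).
- by move=> x; apply: cvgM; [exact: cvg_cst|exact: cvf].
- apply: (@squeeze_cvge _ _ _ _ (cst 0%E) _ (fun n => 'N[mud]_q[EFin \o (G_ n \- G)%R]%E)).
  + apply: nearW => n; rewrite Lnorm_ge0 /=.
    have mGn : measurable_fun setT (G_ n \- G).
      by apply: measurable_funB => //; have [/mem_LfunP[]] := rG n.
    apply: le_trans (Lnorm_fold_derivative mGn).
    rewrite le_eqVlt; apply/orP; left; apply/eqP; apply: eq_Lnorm => x /=.
    by rewrite /fold_derivative /fold_orthants !mulrBr.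
  + exact: cvg_cst.
  + exact: cvG.
Qed.

End fold_unit_ball.

(** * Finiteness of the initial error *)

Section kappa.
Context {R : realType}.
Local Notation mu := (@lebesgue_measure R).

Lemma integral_nonneg_patch (f : R -> \bar R) :
  (\int[mu]_(t in `[0%R, +oo[) f t = \int[mu]_t (if (0 <= t)%R then f t else 0))%E.
Proof.
rewrite integral_mkcond; apply: eq_integral => t _.
by rewrite patchE mem_setE in_itv/= andbT.
Qed.

Variables (r : nat) (p : R) (psi : R -> R).
Hypotheses (p1 : 1 <= p) (psi_ge0 : forall x, 0 <= psi x).
Hypothesis psi_meas : measurable_fun [set: measurableTypeR R] psi.
Hypothesis psi_fin : psi_condition r.+1 p psi.

Definition psi_pos (t : R) : R := if 0 <= t then psi t else 0.

Lemma psi_pos_ge0 t : 0 <= psi_pos t.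
Proof. by rewrite /psi_pos; case: ifP. Qed.

Lemma measurable_psi_pos : measurable_fun [set: measurableTypeR R] psi_pos.
Proof. by apply: measurable_fun_ifT => //; exact: measurable_fun_ler. Qed.

Let kernel (z : measurableTypeR R * measurableTypeR R) : \bar R :=
  (psi_pos z.1 * taylor_kernel r z.1 z.2)%:E.

Let mkernel : measurable_fun setT kernel.
Proof.
apply/measurable_EFinP; apply: measurable_funM; last exact: measurable_taylor_kernel.
exact: (measurableT_comp measurable_psi_pos).
Qed.

Let kernel_ge0 z : (0 <= kernel z)%E.
Proof. by rewrite lee_fin mulr_ge0 ?psi_pos_ge0 ?taylor_kernel_ge0. Qed.

(** The one-dimensional int K(x,y) psi(x) dx; extended-real, because finiteness is obtained only for
    almost every y. *)
Definition kappa (y : R) : \bar R :=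
  (\int[mu]_t (psi_pos t * taylor_kernel r t y)%:E)%E.

Lemma measurable_kappa : measurable_fun [set: measurableTypeR R] kappa.
Proof. by apply: (@measurable_fun_fubini_tonelli_G _ _ _ _ _ mu kernel). Qed.

Lemma kappa_ge0 y : (0 <= kappa y)%E.
Proof. by apply: integral_ge0 => t _; exact: (kernel_ge0 (t, y)). Qed.

Let tail_kernel (z : measurableTypeR R * measurableTypeR R) : \bar R :=
  (if 0 <= z.1 then (z.1 - z.2) ^+ r * \1_(`[z.2, +oo[) z.1 * psi z.1 else 0)%:E.

Let tail_kernel_ge0 z : (0 <= tail_kernel z)%E.
Proof.
rewrite lee_fin; case: ifP => // _; rewrite mulr_ge0 //.
rewrite indicE mem_setE in_itv/= andbT; case: (leP z.2 z.1) => h.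
  by rewrite mulr1 exprn_ge0 // subr_ge0.
by rewrite mulr0.
Qed.

Let mtail_kernel : measurable_fun setT tail_kernel.
Proof.
apply/measurable_EFinP; apply: measurable_fun_ifT => //; first exact: measurable_fun_ler.
apply: measurable_funM; last exact: (measurableT_comp psi_meas).
apply: measurable_funM; first by apply: measurable_funX; exact: measurable_funB.
rewrite (_ : (fun z => _) = (fun z => if z.2 <= z.1 then 1 else 0)).
  by apply: measurable_fun_ifT => //; exact: measurable_fun_ler.
by apply/funext => z; rewrite indicE mem_setE in_itv/= andbT; case: ifP.
Qed.

Lemma psi_tailE y : psi_tail r.+1 psi y = (\int[mu]_t tail_kernel (t, y))%E.
Proof.
rewrite /psi_tail integral_mkcond; apply: eq_integral => t _.
by rewrite patchE mem_setE in_itv/= andbT /tail_kernel /=; case: ifP.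
Qed.

Lemma psi_tail_ge0 y : (0 <= psi_tail r.+1 psi y)%E.
Proof. by rewrite psi_tailE; apply: integral_ge0. Qed.

Lemma measurable_psi_tail : measurable_fun [set: measurableTypeR R] (psi_tail r.+1 psi).
Proof.
rewrite (_ : psi_tail _ _ = fun y => (\int[mu]_t tail_kernel (t, y))%E).
  by apply: (@measurable_fun_fubini_tonelli_G _ _ _ _ _ mu tail_kernel).
by apply/funext => y; exact: psi_tailE.
Qed.

(** The integrands differ by the factor 1 / r! <= 1 and by the cut y >= 0 in the kernel. *)
Lemma kappa_le_psi_tail y : (kappa y <= psi_tail r.+1 psi y)%E.
Proof.
rewrite psi_tailE; apply: ge0_le_integral => //.
- by move=> t _; exact: (kernel_ge0 (t, y)).
- exact: (measurable_fun_pair1 y mkernel).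
- exact: (measurable_fun_pair1 y mtail_kernel).
move=> t _; rewrite lee_fin /psi_pos /=; case: ifP => [t0|_]; last by rewrite mul0r.
rewrite mulrC ler_wpM2r // /taylor_kernel indicE mem_setE in_itv/= andbT.
case: ifP => [/andP[y0 yt]|_].
  rewrite yt mulr1 ler_pdivrMr ?ltr0n ?fact_gt0 // ler_peMr ?exprn_ge0 ?subr_ge0 //.
  by rewrite ler1n fact_gt0.
by case: (leP y t) => h; rewrite ?mulr1 ?mulr0 // exprn_ge0 // subr_ge0.
Qed.

(** For p = 1 this covers x = 0 and x = +oo as well, since the power with exponent 0 is 1. *)
Lemma poweR_mul_self (x : \bar R) : (0 <= x)%E -> (x `^ p = x `^ (p - 1) * x)%E.
Proof.
move=> x0; have p0 : p != 0 by rewrite gt_eqF // (lt_le_trans ltr01).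
have -> : (x `^ p = x `^ (p - 1 + 1))%E by rewrite subrK.
by rewrite poweRD ?poweRe1 //; rewrite /poweRD_def subrK (negbTE p0).
Qed.

(* By Tonelli, psi_condition bounds the integral of kappa * psi_tail `^ (p - 1),
   and kappa <= psi_tail. *)
Lemma kappa_fin : (\int[mu]_y (kappa y `^ p) < +oo)%E.
Proof.
have mh : measurable_fun [set: measurableTypeR R] (fun y => psi_tail r.+1 psi y `^ (p - 1))%E.
  apply: (@measurableT_comp _ _ _ _ _ _ (fun x => x `^ (p - 1))%E).
    exact: measurable_poweR.
  exact: measurable_psi_tail.
apply: le_lt_trans psi_fin.
have -> : (\int[mu]_(t in `[0%R, +oo[)
     (iterated_integral r.+1 (fun y => psi_tail r.+1 psi y `^ (p - 1)) t * (psi t)%:E) =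
   \int[mu]_t \int[mu]_y (kernel (t, y) * psi_tail r.+1 psi y `^ (p - 1)))%E.
  rewrite integral_nonneg_patch; apply: eq_integral => t _.
  have kE y : kernel (t, y) = ((if 0 <= t then psi t else 0) * taylor_kernel r t y)%:E by [].
  under [RHS]eq_integral do rewrite kE.
  case: ifP => t0; last first.
    by under [RHS]eq_integral do rewrite mul0r mul0e; rewrite integral0.
  rewrite iterated_integralE //; last by move=> y; exact: poweR_ge0.
  rewrite muleC -ge0_integralZl_EFin //.
  - by apply: eq_integral => y _; rewrite muleA EFinM.
  - by move=> y _; rewrite mule_ge0 ?poweR_ge0 // lee_fin taylor_kernel_ge0.
  - apply: emeasurable_funM => //; apply/measurable_EFinP.
    exact: measurable_taylor_kernelr.
(* After the exchange of integrals the power of the tail is constant in t. *)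
have inner y : (\int[mu]_t (kernel (t, y) * psi_tail r.+1 psi y `^ (p - 1)) =
    kappa y * psi_tail r.+1 psi y `^ (p - 1))%E.
  rewrite ge0_integralZr //; last exact: poweR_ge0.
  exact: (measurable_fun_pair1 y mkernel).
rewrite (fubini_tonelli (fun z => (kernel z * psi_tail r.+1 psi z.2 `^ (p - 1))%E)).
- under [leRHS]eq_integral do rewrite inner.
  apply: ge0_le_integral => //.
  + by move=> y _; exact: poweR_ge0.
  + apply: (@measurableT_comp _ _ _ _ _ _ (fun x => x `^ p)%E).
      exact: measurable_poweR.
    exact: measurable_kappa.
  + by apply: emeasurable_funM => //; exact: measurable_kappa.
  + move=> y _; rewrite poweR_mul_self ?kappa_ge0 // muleC.
    apply: lee_wpmul2l; first exact: kappa_ge0.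
    apply: gt0_ler_poweR; rewrite ?subr_ge0 ?in_itv/= ?leey ?andbT ?kappa_ge0 ?psi_tail_ge0 //.
    exact: kappa_le_psi_tail.
- apply: emeasurable_funM => //.
  exact: (measurableT_comp mh).
- by move=> z; rewrite mule_ge0 ?poweR_ge0.
Qed.

(** An integrable p-th power is finite a.e., and +oo to a positive power is +oo; so [kappa] has a
    real version. *)
Lemma kappa_representative : exists k : R -> R,
  [/\ measurable_fun [set: R] k, forall y, 0 <= k y,
      {ae mu, forall y, kappa y = (k y)%:E} &
      (\int[mu]_y (k y `^ p)%:E < +oo)%E].
Proof.
have p0 : p != 0 by rewrite gt_eqF // (lt_le_trans ltr01).
have mkp : measurable_fun [set: measurableTypeR R] (fun y => kappa y `^ p)%E.
  apply: (@measurableT_comp _ _ _ _ _ _ (fun x => x `^ p)%E).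
    exact: measurable_poweR.
  exact: measurable_kappa.
have mk : measurable_fun [set: measurableTypeR R] (fine \o kappa).
  exact: (measurableT_comp _ measurable_kappa).
exists (fine \o kappa); split => //.
- by move=> y; rewrite /= fine_ge0 ?kappa_ge0.
- have ip : mu.-integrable setT (fun y => kappa y `^ p)%E.
    apply/integrableP; split => //.
    by under eq_integral do rewrite gee0_abs ?poweR_ge0 //; exact: kappa_fin.
  have := integrable_ae measurableT ip; apply: ae_imp => y /(_ I).
  rewrite /=; case: (kappa y) (kappa_ge0 y) => [k _ _|_|] //.
  by rewrite poweRyr.
- apply: le_lt_trans kappa_fin; apply: ge0_le_integral => //.
  + by move=> y _; rewrite lee_fin powR_ge0.
  + by apply/measurable_EFinP; exact: (measurableT_comp (measurable_powR p) mk).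
  + move=> y _; rewrite /=.
    case: (kappa y) (kappa_ge0 y) => [k _|_|//] //.
    by rewrite poweRyr // leey.
Qed.

End kappa.

(** * Hoelder's inequality, with q = +oo allowed *)

Lemma hoelder_exponents (R : realType) (p : R) (q : \bar R) :
  (1 < q)%E -> (p%:E^-1 + q^-1 = 1)%E ->
  (q = +oo%E /\ p = 1) \/
  exists q' : R, [/\ q = q'%:E, 1 < q', 0 < p & p^-1 + q'^-1 = 1].
Proof.
case: q => [q| |//] q1; last first.
  by rewrite invey adde0 => /eqP; rewrite inve_eq1 eqe => /eqP ->; left.
move: q1; rewrite lte_fin => q1; have q0 : 0 < q by exact: lt_trans ltr01 q1.
rewrite !inver (gt_eqF q0); case: eqVneq => // p0 [pq].
right; exists q; split => //.
rewrite -invr_gt0; have -> : p^-1 = 1 - q^-1 by rewrite -pq addrK.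
by rewrite subr_gt0 invf_lt1.
Qed.

Lemma Lnorm_hoelder d (T : measurableType d) (R : realType)
    (mu : {measure set T -> \bar R}) (f g : T -> R) (p : R) (q : \bar R) :
  (1 < q)%E -> (p%:E^-1 + q^-1 = 1)%E ->
  measurable_fun setT f -> measurable_fun setT g ->
  (\int[mu]_x `|f x * g x|%:E <= 'N[mu]_p%:E[EFin \o f] * 'N[mu]_q[EFin \o g])%E.
Proof.
move=> q1 pq mf mg; have mfg : measurable_fun setT (EFin \o (f \* g)).
  by apply/measurable_EFinP; exact: measurable_funM.
have E1 h : (\int[mu]_x `|h x|%:E = 'N[mu]_1[EFin \o h])%E by rewrite Lnorm1.
have [[-> ->]|[q' [-> q'1 p0 pq']]] := hoelder_exponents q1 pq; last first.
  by rewrite (E1 (f \* g)) hoelder // (lt_trans ltr01).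
(* For q = +oo the norm is the essential supremum, except on a space of measure zero, where it is 0
   by definition and the left side is 0 too. *)
rewrite -E1 [in X in (_ * X)%E]unlock; case: ifPn => mu0.
  have mf' : measurable_fun setT (fun x => `|f x|%:E).
    by apply/measurable_EFinP; exact: measurableT_comp.
  rewrite -ge0_integralZr //; last first.
    by apply: ess_sup_gee => //; apply: aeW => x /=.
  apply: ae_ge0_le_integral => //.
  - by move: mfg => /(measurableT_comp (@abse_measurable R setT)).
  - move=> x _; rewrite mule_ge0 //.
    by apply: ess_sup_gee => //; apply: aeW => y /=.
  - by apply: emeasurable_funM => //; exact: measurable_cst.
  - apply: ae_imp (ess_sup_ge mu (abse \o (EFin \o g))) => x gx _.
    by rewrite normrM EFinM lee_wpmul2l.
rewrite null_set_integral ?mule0 //.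
- by move: mfg => /(measurableT_comp (@abse_measurable R setT)).
- by apply/eqP; rewrite eq_le measure_ge0 andbT leNgt.
Qed.

Lemma hoelder_conjugate_ge1 (R : realType) (p : R) (q : \bar R) :
  (1 < q)%E -> (p%:E^-1 + q^-1 = 1)%E -> 1 <= p.
Proof.
move=> q1 pq; have [[_ ->//]|[q' [_ q'1 p0 pq']]] := hoelder_exponents q1 pq.
rewrite -invf_le1 // -pq' lerDl invr_ge0.
exact: le_trans ler01 (ltW q'1).
Qed.

Lemma powR_prod (R : realType) d (a : 'I_d -> R) (p : R) : (forall j, 0 <= a j) ->
  (\prod_(j < d) a j) `^ p = \prod_(j < d) (a j `^ p).
Proof.
(* Nonnegativity of the partial product is carried along, as [powRM] needs it. *)
move=> a0; suff [] : 0 <= \prod_(j < d) a j /\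
  (\prod_(j < d) a j) `^ p = \prod_(j < d) (a j `^ p) by [].
elim/big_rec2: _ => [|j x y _ [x0 <-]]; first by rewrite powR1.
by rewrite mulr_ge0 // powRM.
Qed.

(** * Integral bound on the positive orthant *)

Section weighted_bound.
Context {R : realType}.
Variables (d r : nat) (p : R) (q : \bar R) (psi : R -> R).
Local Notation mu := (@lebesgue_measure R).
Local Notation mud := (lebesgue_Rn R d).
Hypotheses (q_gt1 : (1 < q)%E) (pq_conj : (p%:E^-1 + q^-1 = 1)%E).
Hypothesis psi_ge0 : forall x, 0 <= psi x.
Hypothesis psi_meas : measurable_fun [set: measurableTypeR R] psi.
Hypothesis psi_fin : psi_condition r.+1 p psi.
Implicit Types (f G : Rn R d -> R) (x y : Rn R d).

Let p_ge1 : 1 <= p := hoelder_conjugate_ge1 q_gt1 pq_conj.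

Definition weight_pos x : R := \prod_(j < d) psi_pos psi (tnth x j).

Definition kernel_Rn x y : R := \prod_(j < d) taylor_kernel r (tnth x j) (tnth y j).

Lemma weight_pos_ge0 x : 0 <= weight_pos x.
Proof. by rewrite prodr_ge0 // => j _; exact: psi_pos_ge0. Qed.

Lemma kernel_Rn_ge0 x y : 0 <= kernel_Rn x y.
Proof. by rewrite prodr_ge0 // => j _; exact: taylor_kernel_ge0. Qed.

Lemma measurable_weight_pos : measurable_fun setT weight_pos.
Proof.
apply: (measurable_prod_coord (phi := fun _ => psi_pos psi)) => j.
exact: measurable_psi_pos.
Qed.

Lemma measurable_kernel_Rn :
  measurable_fun [set: Rn R d * Rn R d] (fun z => kernel_Rn z.1 z.2).
Proof.
apply: measurable_prod => j _.
have mk := @measurable_taylor_kernel R r.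
have mz : measurable_fun [set: Rn R d * Rn R d]
    (fun z => (tnth z.1 j, tnth z.2 j) : measurableTypeR R * measurableTypeR R).
  have mj := @measurable_coord R d j.
  apply/measurable_fun_pairP; split => /=.
    exact: (measurableT_comp mj measurable_fst).
  exact: (measurableT_comp mj measurable_snd).
exact: (measurableT_comp mk mz).
Qed.

(** Taylor's formula in every coordinate writes each elementary tensor as an integral of a product;
    summing gives the kernel against the mixed derivative, a.e. equal to [G]. *)
Lemma tensor_kernel_bound f G x : algebraic_tensor r.+1 q f ->
  Lq_representative mud q (mixed_derivative r.+1 f) G ->
  (forall j, 0 <= tnth x j) ->
  (`|f x|%:E <= \int[mud]_y (kernel_Rn x y * `|G y|)%:E)%E.
Proof.
move=> [n [g [sg ->]]] [LG fG] x0.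
have /choice[h0 gh0] : forall k : 'I_n * 'I_d, exists h : R -> R,
    Lq_representative mu q (derive1n r.+1 (g k.1 k.2)) h.
  by move=> k; have [] := sg k.1 k.2.
pose h k j := h0 (k, j).
have gh k j : Lq_representative mu q (derive1n r.+1 (g k j)) (h k j) by exact: (gh0 (k, j)).
have mh k j : measurable_fun [set: R] (h k j) by have [/mem_LfunP[]] := gh k j.
have M1 := mixed_derivative_tensor_ae sg (fun k j => (gh k j).2).
have M3 : {ae mud, forall y, G y = \sum_(k < n) \prod_(j < d) h k j (tnth y j)}.
  by apply: ae_imp2 fG M1 => y <-.
pose phi k j (t : R) := taylor_kernel r (tnth x j) t * h k j t.
have T k j := sobolev0_taylor (sg k j) (mh k j) (gh k j).2 (x0 j).
have iphi k j : mu.-integrable setT (EFin \o phi k j) by have [] := T k j.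
have gphi k j : g k j (tnth x j) = \int[mu]_y phi k j y.
  by apply: EFin_inj; have [_ ->] := T k j; rewrite /Rintegral fineK //;
    exact: (integrable_fin_num measurableT (iphi k j)).
have -> : `|\sum_(k < n) \prod_(j < d) g k j (tnth x j)|%:E =
    (`|\int[mud]_y \sum_(k < n) (\prod_(j < d) phi k j (tnth y j))%:E|)%E.
  rewrite -abse_EFin; congr (`|_|)%E.
  rewrite integral_sum //; last by move=> k; exact: integrable_prod_coord.
  rewrite -sumEFin; apply: eq_bigr => k _; rewrite integral_prod_coord //.
  by congr EFin; apply: eq_bigr => j _; exact: gphi.
have mphi : measurable_fun setT
    (fun y => \sum_(k < n) (\prod_(j < d) phi k j (tnth y j))%:E)%E.
  apply: emeasurable_sum => k; apply/measurable_EFinP; apply: measurable_prod_coord => j.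
  by apply: measurable_funM => //; exact: measurable_taylor_kernelr.
apply: le_trans (le_abse_integral mud measurableT mphi) _.
have [mG _] := (mem_LfunP _ _ _).1 LG.
apply: ae_ge0_le_integral => //.
- exact: measurableT_comp.
- by move=> y _; rewrite lee_fin mulr_ge0 ?kernel_Rn_ge0.
- apply/measurable_EFinP; apply: measurable_funM; last exact: measurableT_comp.
  exact: (measurable_fun_pair2 x measurable_kernel_Rn).
apply: ae_imp M3 => y Gy _.
rewrite sumEFin abse_EFin lee_fin Gy.
have -> : \sum_(k < n) \prod_(j < d) phi k j (tnth y j) =
    kernel_Rn x y * \sum_(k < n) \prod_(j < d) h k j (tnth y j).
  by rewrite mulr_sumr; apply: eq_bigr => k _; rewrite /kernel_Rn -big_split.
by rewrite normrM ger0_norm ?kernel_Rn_ge0.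
Qed.

Lemma algebraic_tensor_measurable f : algebraic_tensor r.+1 q f -> measurable_fun setT f.
Proof.
move=> [n [g [sg ->]]]; apply: measurable_sum => k; apply: measurable_prod_coord => j.
have mg i l : measurable_fun [set: R] (g i l).
  apply: continuous_measurable_fun.
  exact: (sobolev0_continuous (sg i l) (leq0n r)).
exact: mg.
Qed.

Lemma tensor_weight_bound : exists2 C : R, 0 <= C & forall f G,
  algebraic_tensor r.+1 q f ->
  Lq_representative mud q (mixed_derivative r.+1 f) G ->
  (\int[mud]_x (`|f x| * weight_pos x)%:E <= C%:E * 'N[mud]_q[EFin \o G])%E.
Proof.
have [k [mk k0 kappaE kfin]] := kappa_representative p_ge1 psi_ge0 psi_meas psi_fin.
pose K (y : Rn R d) := \prod_(j < d) k (tnth y j).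
have mK : measurable_fun setT K by exact: (measurable_prod_coord (fun _ : 'I_d => mk)).
have p0 : p != 0 by rewrite gt_eqF // (lt_le_trans ltr01).
(* The p-th power of this norm factors into d one-dimensional integrals, finite by [kfin]. *)
have Kfin : ('N[mud]_p%:E[EFin \o K] < +oo)%E.
  rewrite unlock; apply: poweR_lty.
  rewrite (eq_integral (fun y : Rn R d => (\prod_(j < d) (k (tnth y j) `^ p))%:E)); last first.
    by move=> y _; rewrite /= ger0_norm ?prodr_ge0 // /K powR_prod.
  rewrite (ge0_integral_prod_coord (phi := fun j t => k t `^ p)); last 2 first.
  - by move=> j; exact: (measurableT_comp (measurable_powR p) mk).
  - by move=> j t; exact: powR_ge0.
  rewrite ltey_eq prode_fin_num // => j _; rewrite ge0_fin_numE //.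
  by apply: integral_ge0 => t _; rewrite lee_fin powR_ge0.
exists (fine 'N[mud]_p%:E[EFin \o K]); first by rewrite fine_ge0 // Lnorm_ge0.
move=> f G af rG; rewrite fineK ?ge0_fin_numE ?Lnorm_ge0 //.
have mf := algebraic_tensor_measurable af.
have [/mem_LfunP[mG _] _] := rG.
apply: le_trans (Lnorm_hoelder mud q_gt1 pq_conj mK mG).
pose F (z : Rn R d * Rn R d) : R := weight_pos z.1 * kernel_Rn z.1 z.2 * `|G z.2|.
have mF : measurable_fun setT (EFin \o F).
  apply/measurable_EFinP; apply: measurable_funM.
    apply: measurable_funM; last exact: measurable_kernel_Rn.
    exact: (measurableT_comp measurable_weight_pos).
  by apply: measurableT_comp => //; exact: (measurableT_comp mG).
have F0 z : (0 <= (EFin \o F) z)%E.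
  by rewrite lee_fin !mulr_ge0 ?weight_pos_ge0 ?kernel_Rn_ge0.
apply: (@le_trans _ _ (\int[mud]_x \int[mud]_y (EFin \o F) (x, y))%E).
  apply: ge0_le_integral => //.
  - by move=> x _; rewrite lee_fin mulr_ge0 ?weight_pos_ge0.
  - apply/measurable_EFinP; apply: measurable_funM; last exact: measurable_weight_pos.
    exact: measurableT_comp.
  - by apply: (@measurable_fun_fubini_tonelli_F _ _ _ _ _ mud (EFin \o F)).
  - move=> x _; rewrite mulrC EFinM.
    (* Where some coordinate is negative the weight vanishes, so the kernel bound is needed on the
       positive orthant only. *)
    have [x0|/existsNP[j /negP]] := pselect (forall j, 0 <= tnth x j); last first.
      rewrite -ltNge => xj; rewrite (_ : weight_pos x = 0) ?mul0e ?integral_ge0 //.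
      by rewrite /weight_pos (bigD1 j) //= /psi_pos leNgt xj mul0r.
    rewrite /F /=; under eq_integral do rewrite -mulrA EFinM.
    rewrite ge0_integralZl_EFin ?weight_pos_ge0 //.
    + by rewrite lee_wpmul2l ?lee_fin ?weight_pos_ge0 //; exact: tensor_kernel_bound.
    + by move=> y _; rewrite lee_fin mulr_ge0 ?kernel_Rn_ge0.
    + apply/measurable_EFinP; apply: measurable_funM; last exact: measurableT_comp.
      exact: (measurable_fun_pair2 x measurable_kernel_Rn).
rewrite (fubini_tonelli (EFin \o F)) //.
have inner y : (\int[mud]_x (EFin \o F) (x, y) =
    (\prod_(j < d) kappa r psi (tnth y j)) * `|G y|%:E)%E.
  rewrite -(ge0_integral_prod_coord (phi := fun j t => psi_pos psi t * taylor_kernel r t (tnth y j))).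
  - rewrite -ge0_integralZr //.
    + by apply: eq_integral => x _; rewrite /F /= big_split EFinM.
    + apply/measurable_EFinP; apply: (measurable_prod_coord
        (phi := fun j t => psi_pos psi t * taylor_kernel r t (tnth y j))) => j.
      by apply: measurable_funM; [exact: measurable_psi_pos|exact: measurable_taylor_kernell].
    + by move=> x _; rewrite lee_fin prodr_ge0 // => j _; rewrite mulr_ge0 ?psi_pos_ge0 ?taylor_kernel_ge0.
  - by move=> j; apply: measurable_funM; [exact: measurable_psi_pos|exact: measurable_taylor_kernell].
  - by move=> j t; rewrite mulr_ge0 ?psi_pos_ge0 ?taylor_kernel_ge0.
apply: ae_ge0_le_integral => //.
- by move=> y _; exact: integral_ge0.
- by apply: (@measurable_fun_fubini_tonelli_G _ _ _ _ _ mud (EFin \o F)).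
- apply/measurable_EFinP; apply: measurableT_comp => //; exact: measurable_funM.
- have := ae_coord (fun=> kappaE) (d := d); apply: ae_imp => y kE _.
  rewrite inner (eq_bigr (fun j => (k (tnth y j))%:E)); last by move=> j _; exact: kE.
  by rewrite prodEFin -EFinM normrM [`|K y|]ger0_norm // prodr_ge0.
Qed.

Lemma unit_ball_measurable f : tensor_unit_ball r.+1 q f -> measurable_fun setT f.
Proof.
move=> [G [LG [f_ [G_ [af rG cvf cvG]]]] G1].
apply: (measurable_fun_cvg (h := f_)); last by move=> x _; exact: cvf.
by move=> n; exact: algebraic_tensor_measurable.
Qed.

Lemma unit_ball_weight_bound : exists2 C : R, 0 <= C & forall f,
  tensor_unit_ball r.+1 q f ->
  (\int[mud]_x (`|f x| * weight_pos x)%:E <= C%:E)%E.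
Proof.
have q1 : (1 <= q)%E by exact: ltW.
have [C C0 HC] := tensor_weight_bound.
exists (C * 2); first by rewrite mulr_ge0.
move=> f [G [LG [f_ [G_ [af rG cvf cvG]]]] G1].
have [mG _] := (mem_LfunP _ _ _).1 LG.
have mGn n : measurable_fun setT (G_ n) by have [/mem_LfunP[]] := rG n.
have mfn n : measurable_fun setT (f_ n) by exact: algebraic_tensor_measurable.
(* From N on, Minkowski's inequality bounds the norm of [G_ n] by 1 + 1, whence the constant C *
   2. *)
have [N _ HN] : \forall n \near \oo, ('N[mud]_q[EFin \o (G_ n \- G)%R] <= 1)%E.
  have [fin /cvgrPdist_le/(_ 1 ltr01)] := (fine_cvgP _ _).1 cvG.
  apply: filterS2 fin => n fin; rewrite sub0r normrN => /(le_trans (ler_norm _)).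
  by rewrite -lee_fin /= fineK.
have bound n : (\int[mud]_x (`|f_ (n + N)%N x| * weight_pos x)%:E <= (C * 2)%:E)%E.
  apply: le_trans (HC _ _ (af _) (rG _)) _; rewrite EFinM lee_wpmul2l ?lee_fin //.
  have -> : EFin \o G_ (n + N)%N = EFin \o ((G_ (n + N)%N \- G) \+ G)%R.
    by apply/funext => x /=; rewrite subrK.
  apply: le_trans (eminkowski mud _ mG q1) _; first exact: measurable_funB.
  by rewrite -[2]/(1 + 1) EFinD leeD // HN //= leq_addl.
have mF n : measurable_fun setT (fun x => (`|f_ (n + N)%N x| * weight_pos x)%:E).
  apply/measurable_EFinP; apply: measurable_funM; last exact: measurable_weight_pos.
  exact: measurableT_comp.
have F0 n x : setT x -> (0 <= (`|f_ (n + N)%N x| * weight_pos x)%:E)%E.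
  by move=> _; rewrite lee_fin mulr_ge0 ?weight_pos_ge0.
(* The [f_ n] are only known to converge pointwise, so the bound is passed on by Fatou's lemma. *)
have := fatou mud measurableT mF F0.
have -> : (\int[mud]_x limn_einf (fun n => (`|f_ (n + N)%N x| * weight_pos x)%:E) =
    \int[mud]_x (`|f x| * weight_pos x)%:E)%E.
  apply: eq_integral => x _; apply: (cvg_limn_einf_sup _).1.
  apply: cvg_EFin; first exact: nearW.
  apply: cvgM; last exact: cvg_cst.
  apply: cvg_norm; rewrite (cvg_shiftn N (f_ ^~ x)); exact: cvf.
move/le_trans; apply; rewrite limn_einf_lim.
apply: lime_le; first exact: is_cvg_einfs.
apply: nearW => n; apply: le_trans (bound n).
by apply: ereal_inf_lbound; exists n => /=.
Qed.

End weighted_bound.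

(** * Positivity of the initial error *)

Section bump.
Context {R : realType}.
Local Notation mu := (@lebesgue_measure R).
Implicit Types (k : nat) (t : R).

Definition truncated_power k : R -> R := half_line false (fun t => t ^+ k / k`!%:R).

(* k-fold antiderivative of the indicator of ]0, 1[. *)
Definition bump k t : R := truncated_power k t - truncated_power k (t - 1).

Lemma truncated_powerE k t : truncated_power k t = if 0 <= t then t ^+ k / k`!%:R else 0.
Proof. by rewrite /truncated_power /half_line eqbF_neg -leNgt. Qed.

Lemma truncated_power1E t : truncated_power 1 t = if 0 <= t then t else 0.
Proof. by rewrite truncated_powerE expr1 (_ : 1`!%:R = 1) ?divr1. Qed.

Lemma is_derive_monomial k t :
  is_derive t 1 (fun t => t ^+ k.+1 / k.+1`!%:R) (t ^+ k / k`!%:R : R).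
Proof.
have -> : (fun t => t ^+ k.+1 / k.+1`!%:R) = (k.+1`!%:R)^-1 *: (id ^+ k.+1) :> (R -> R).
  by apply/funext => s; rewrite /= fctE; exact: mulrC.
apply: is_derive_eq; rewrite /GRing.scale /= mulr1 factS natrM invfM.
by rewrite mulrACA mulVf ?mul1r ?pnatr_eq0 // mulrC.
Qed.

(** From degree 2 on, the monomial and its derivative vanish at 0, so truncation leaves no
    corner. *)
Lemma is_derive_truncated_power k t :
  is_derive t 1 (truncated_power k.+2) (truncated_power k.+1 t).
Proof.
have D s : derive1 (fun t => t ^+ k.+2 / k.+2`!%:R) s = s ^+ k.+1 / k.+1`!%:R.
  by rewrite derive1E; have [_ ->] := is_derive_monomial k.+1 s.
have -> : truncated_power k.+1 t = half_line false (derive1 (fun t => t ^+ k.+2 / k.+2`!%:R)) t.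
  by rewrite /truncated_power /half_line D.
apply: is_derive_half_line.
- by move=> s; have [] := is_derive_monomial k.+1 s.
- by rewrite expr0n mul0r.
- by rewrite D expr0n mul0r.
Qed.

Lemma is_derive_bump k t : is_derive t 1 (bump k.+2) (bump k.+1 t).
Proof.
have d1 := is_derive_truncated_power k t.
have d2 := is_derive_truncated_power k (t - 1).
have d3 : is_derive t 1 (fun s : R => s - 1) 1 by apply: is_derive_eq; rewrite subr0.
have := @is_derive1_comp _ (truncated_power k.+2) (fun s => s - 1) t _ _ d2 d3.
rewrite mulr1 => d4.
have -> : bump k.+2 = truncated_power k.+2 - (truncated_power k.+2 \o (fun s => s - 1)) by [].
exact: is_deriveB.
Qed.

Lemma derive1n_bump r j : (j <= r)%N -> derive1n j (bump r.+1) = bump (r - j).+1.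
Proof.
elim: j => [|j ih] jr; first by rewrite subn0.
rewrite derive1nS ih 1?ltnW //; apply/funext => t; rewrite derive1E.
have -> : (r - j = (r - j.+1).+1)%N by rewrite subnSK.
by have [_ ->] := is_derive_bump (r - j.+1) t.
Qed.

(** [bump 1] is the ramp rising from 0 to 1 on [0, 1]; the Lipschitz bound yields the absolute
    continuity that [sobolev0] requires. *)
Lemma bump1_lipschitz s t : s <= t -> `|bump 1 t - bump 1 s| <= t - s.
Proof.
move=> st; rewrite /bump !truncated_power1E !subr_ge0.
by rewrite ler_norml; case: (leP 0 s) => ?; case: (leP 0 t) => ?; case: (leP 1 s) => ?;
  case: (leP 1 t) => ?; apply/andP; split; lra.
Qed.

Lemma bump_ge0 k t : 0 <= bump k t.
Proof.
rewrite /bump !truncated_powerE subr_ge0; case: ifP => t1; last first.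
  by case: ifP => // t0; rewrite divr_ge0 // exprn_ge0.
have t0 : 0 <= t by lra.
by rewrite t0 ler_pM2r ?invr_gt0 ?ltr0n ?fact_gt0 // lerXn2r ?nnegrE //; lra.
Qed.

Lemma bump_gt0 k t : 0 < t -> 0 < bump k.+1 t.
Proof.
move=> t0; rewrite /bump !truncated_powerE (ltW t0) subr_gt0.
case: ifP => t1; last by rewrite divr_gt0 ?exprn_gt0 ?ltr0n ?fact_gt0.
by rewrite ltr_pM2r ?invr_gt0 ?ltr0n ?fact_gt0 // ltrXn2r ?nnegrE ?(ltW t0) //; lra.
Qed.

Lemma derive1_bump1 t : t != 0 -> t != 1 -> derive1 (bump 1) t = \1_(`]0, 1[) t.
Proof.
move=> t0 t1.
have tp (s : R) : s != 0 -> is_derive s 1 (truncated_power 1) ((0 < s)%R%:R).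
  move=> s0; have dm : (fun u : R => u ^+ 1 / 1`!%:R) = id.
    by apply/funext => u; rewrite expr1 (_ : 1`!%:R = 1) ?divr1.
  have E := near_half_line false (fun u : R => u ^+ 1 / 1`!%:R) s0.
  have : is_derive s 1 (if (s < 0) == false then (fun u : R => u ^+ 1 / 1`!%:R) else cst 0)
      ((0 < s)%R%:R).
    have [sneg|spos|/eqP] := ltgtP s 0; last by rewrite (negbTE s0).
      exact: is_derive_cst.
    by rewrite dm; exact: is_derive_id.
  by apply: near_eq_is_derive; apply: filterS E => u; rewrite /truncated_power => ->.
have d1 := tp t t0.
have d2 : is_derive (t - 1) 1 (truncated_power 1) ((0 < t - 1)%R%:R) by apply: tp; rewrite subr_eq0.
have d3 : is_derive t 1 (fun s : R => s - 1) 1 by apply: is_derive_eq; rewrite subr0.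
have := @is_derive1_comp _ (truncated_power 1) (fun s => s - 1) t _ _ d2 d3.
rewrite mulr1 => d4.
have d5 : is_derive t 1 (truncated_power 1 - (truncated_power 1 \o (fun s => s - 1)))
    ((0 < t)%R%:R - (0 < t - 1)%R%:R) by exact: is_deriveB.
rewrite derive1E; have [_ ->] := d5.
rewrite indicE mem_setE in_itv/= subr_gt0; move: t0 t1.
by case: (ltgtP 0 t) => // ?; case: (ltgtP t 1) => // ? _ _; rewrite ?subr0 ?subrr //; lra.
Qed.

End bump.

(** A function with values 0 and 1 equals its own q-th power, and for q = +oo it is bounded by 1. *)
Lemma Lnorm_indicator_le1 d (T : measurableType d) (R : realType)
    (mu : {measure set T -> \bar R}) (q : \bar R) (f : T -> R) :
  (1 <= q)%E -> (forall x, f x = 0 \/ f x = 1) -> (\int[mu]_x (f x)%:E <= 1)%E ->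
  ('N[mu]_q[EFin \o f] <= 1)%E.
Proof.
move=> q1 f01 intf; rewrite unlock; case: q q1 => [q q1| _|//].
  have q0 : 0 < q by exact: lt_le_trans ltr01 q1.
  rewrite (eq_integral (fun x => (f x)%:E)); last first.
    move=> x _ /=; have [->|->] := f01 x; rewrite ?normr0 ?normr1 ?powR1 //.
    by rewrite powR0 // gt_eqF.
  have int0 : (0 <= \int[mu]_x (f x)%:E)%E.
    by apply: integral_ge0 => x _; have [->|->] := f01 x.
  rewrite -(poweR1r q^-1); apply: gt0_ler_poweR; rewrite ?invr_ge0 ?in_itv/= ?leey ?andbT //.
  exact: ltW.
case: ifP => // mu0; apply/ess_supP; apply: aeW => x /=.
by have [->|->] := f01 x; rewrite ?normr0 ?normr1 lee_fin.
Qed.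

Section positivity.
Context {R : realType}.
Variables (d r : nat) (q : \bar R) (psi : R -> R).
Local Notation mu := (@lebesgue_measure R).
Local Notation mud := (lebesgue_Rn R d).
Hypothesis q1 : (1 <= q)%E.
Hypothesis psi_meas : measurable_fun [set: measurableTypeR R] psi.
Hypothesis psi_ge0 : forall x, 0 <= psi x.
Hypothesis psi_int1 : (\int[mu]_x (psi x)%:E = 1)%E.
Hypothesis psi_sym : forall x, psi x = psi (- x).

Let ind01 : R -> R := \1_(`]0, 1[).

Lemma ind01_01 t : ind01 t = 0 \/ ind01 t = 1.
Proof. by rewrite /ind01 indicE; case: (_ \in _); [right|left]. Qed.

Lemma measurable_ind01 : measurable_fun [set: R] ind01.
Proof. exact: measurable_indic. Qed.

Lemma integral_ind01 : (\int[mu]_t (ind01 t)%:E = 1)%E.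
Proof.
rewrite integral_indic //= setIT lebesgue_measure_itv /= lte_fin ltr01.
by rewrite oppr0 adde0.
Qed.

Lemma bump_representative : Lq_representative mu q (derive1n r.+1 (bump r.+1)) ind01.
Proof.
split.
  apply/mem_LfunP; split; first exact: measurable_ind01.
  apply: (@le_lt_trans _ _ 1%E); last exact: ltry.
  by apply: Lnorm_indicator_le1 => //; [exact: ind01_01|rewrite integral_ind01].
exists [set 0; 1]; split.
- by apply: measurableU; exact: measurable_set1.
- apply: null_set_setU; [exact: measurable_set1|exact: measurable_set1| |];
    exact: lebesgue_measure_set1.
- move=> t /= nt; apply: contrapT => /not_orP[/eqP t0 /eqP t1]; apply: nt.
  by rewrite derive1n_bump // subnn derive1_bump1.
Qed.

Lemma sobolev0_bump : sobolev0 r.+1 q (bump r.+1).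
Proof.
split.
- move=> j; rewrite ltnS => jr; rewrite derive1n_bump // /bump !truncated_powerE.
  by rewrite lexx expr0n mul0r subr_ge0 ler10 subrr.
- move=> j x; rewrite ltnS => jr; rewrite derive1n_bump 1?ltnW //.
  have -> : (r - j = (r - j.+1).+1)%N by rewrite subnSK.
  by have [] := is_derive_bump (r - j.+1) x.
- move=> a b e e0; exists e => // n u v uv sep; rewrite derive1n_bump // subnn.
  apply: le_lt_trans; apply: ler_sum => i _; apply: bump1_lipschitz.
  by have [] := uv i.
- by exists ind01; exact: bump_representative.
Qed.

Definition bump_Rn (x : Rn R d) : R := \prod_(j < d) bump r.+1 (tnth x j).

(** The product is itself a tensor, so constant sequences approximate it; its mixed derivative is
    a.e. the indicator of the open unit cube, of volume 1. *)
Lemma bump_Rn_unit_ball : tensor_unit_ball r.+1 q bump_Rn.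
Proof.
pose G (x : Rn R d) : R := \prod_(j < d) ind01 (tnth x j).
have mG : measurable_fun setT G.
  exact: (measurable_prod_coord (fun _ : 'I_d => measurable_ind01)).
have G1 : ('N[mud]_q[EFin \o G] <= 1)%E.
  apply: Lnorm_indicator_le1 => //.
    move=> x; rewrite /G; elim/big_ind: _; [by right| |by move=> j _; exact: ind01_01].
    by move=> a b [->|->] [->|->]; rewrite ?mul0r ?mulr0 ?mulr1; by [left|right].
  rewrite (ge0_integral_prod_coord (phi := fun _ => ind01)).
  - by rewrite big1 // => j _; exact: integral_ind01.
  - by move=> _; exact: measurable_ind01.
  - by move=> _ t; rewrite /ind01 indicE.
have LG : G \in Lfun mud q.
  by apply/mem_LfunP; split => //; apply: le_lt_trans G1 _; rewrite ltry.
have fE : bump_Rn = (fun x => \sum_(k < 1) \prod_(j < d) bump r.+1 (tnth x j)).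
  by apply/funext => x; rewrite big_ord1.
exists G => //; split => //.
exists (fun _ => bump_Rn), (fun _ => G); split.
- by move=> _; rewrite fE; exists 1%N, (fun _ _ => bump r.+1); split => // _ _;
    exact: sobolev0_bump.
- move=> _; split => //; rewrite fE.
  have := mixed_derivative_tensor_ae (g := fun (k : 'I_1) (j : 'I_d) => bump r.+1)
    (fun _ _ => sobolev0_bump) (h := fun _ _ => ind01) (fun _ _ => bump_representative.2).
  by apply: ae_imp => x ->; rewrite big_ord1.
- by move=> x; exact: cvg_cst.
- have -> : EFin \o (G \- G)%R = cst 0%E by apply/funext => x /=; rewrite subrr.
  rewrite Lnorm0; first exact: cvg_cst.
  by rewrite gt_eqF // (lt_le_trans _ q1).
Qed.

(** The bump is positive on all of ]0, +oo[. A zero integral would make [psi] vanish a.e. there, by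
    symmetry a.e. on R, against its total mass 1. *)
Lemma bump_psi_gt0 : (0 < \int[mu]_t (bump r.+1 t * psi t)%:E)%E.
Proof.
have mb : measurable_fun [set: R] (bump r.+1).
  apply: continuous_measurable_fun; exact: (sobolev0_continuous sobolev0_bump (leq0n r)).
have mbp : measurable_fun [set: measurableTypeR R] (fun t => (bump r.+1 t * psi t)%:E).
  by apply/measurable_EFinP; exact: measurable_funM.
have bp0 t : (0 <= (bump r.+1 t * psi t)%:E)%E by rewrite lee_fin mulr_ge0 ?bump_ge0.
rewrite lt_neqAle integral_ge0 ?andbT //; apply/negP => /eqP int0.
have ae0 : {ae mu, forall t, 0 < t -> psi t = 0}.
  have := (ae_eq_integral_abs mu measurableT mbp).1.
  move=> /(_ _)[|N [mN N0 NP]].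
    by under eq_integral do rewrite gee0_abs //; rewrite -int0.
  exists N; split => // t /= nt; apply: NP => /= H; apply: nt => t0.
  have /eqP := H I; rewrite eqe mulf_eq0 gt_eqF ?bump_gt0 //= => /eqP.
  exact.
have ae0N := measure_preserving_ae (measure_preserving_oppr R) ae0.
have n0 : {ae mu, forall x : R, x != 0}.
  exists [set 0]; split; [exact: measurable_set1|exact: lebesgue_measure_set1|].
  by move=> x /= /negP; rewrite negbK => /eqP.
have psi0 : {ae mu, forall t, psi t = 0}.
  have H12 : {ae mu, forall t, (0 < t -> psi t = 0) /\ (0 < - t -> psi (- t) = 0)}.
    by apply: ae_imp2 ae0 ae0N.
  apply: ae_imp2 n0 H12 => t t0 [H1 H2].
  have [tneg|tpos|/eqP] := ltgtP t 0; last by rewrite (negbTE t0).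
    by rewrite psi_sym H2 // oppr_gt0.
  exact: H1.
have := psi_int1; rewrite (ae_eq_integral (cst 0%E)) //.
- by rewrite integral0 => /eqP; rewrite eqe eq_sym oner_eq0.
- exact/measurable_EFinP.
- by apply: ae_imp psi0 => t -> _.
Qed.

Lemma initial_error_gt0 : (0 < initial_error r.+1 q psi d)%E.
Proof.
apply: (@lt_le_trans _ _ `|weighted_integral psi bump_Rn|%E); last first.
  by apply: ereal_sup_ubound; exists bump_Rn => //; exact: bump_Rn_unit_ball.
have -> : weighted_integral psi bump_Rn = (\prod_(j < d) \int[mu]_t (bump r.+1 t * psi t)%:E)%E.
  rewrite -(ge0_integral_prod_coord (phi := fun _ t => bump r.+1 t * psi t)).
  - by apply: eq_integral => x _; rewrite /bump_Rn -big_split.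
  - move=> _; apply: measurable_funM => //; apply: continuous_measurable_fun.
    exact: (sobolev0_continuous sobolev0_bump (leq0n r)).
  - by move=> _ t; rewrite mulr_ge0 ?bump_ge0.
rewrite gee0_abs; last by apply: prode_ge0 => j _; exact/ltW/bump_psi_gt0.
elim/big_ind: _ => //; first by move=> a b; exact: mule_gt0.
by move=> j _; exact: bump_psi_gt0.
Qed.

End positivity.

(** * The lower bound *)

Section lower_bound.
Context {R : realType}.
Variables (d r : nat) (p : R) (q : \bar R) (psi : R -> R).
Local Notation mu := (@lebesgue_measure R).
Local Notation mud := (lebesgue_Rn R d).
Local Notation signs := {ffun 'I_d -> bool}.
Hypotheses (q_gt1 : (1 < q)%E) (pq_conj : (p%:E^-1 + q^-1 = 1)%E).
Hypothesis psi_ge0 : forall x, 0 <= psi x.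
Hypothesis psi_meas : measurable_fun [set: measurableTypeR R] psi.
Hypothesis psi_sym : forall x, psi x = psi (- x).
Hypothesis psi_fin : psi_condition r.+1 p psi.
Implicit Types (f : Rn R d -> R) (x : Rn R d) (S : {set signs}) (b : signs).

Local Notation ball := (@tensor_unit_ball R d r.+1 q).

Let q_ge1 : (1 <= q)%E := ltW q_gt1.

Definition weight x : R := \prod_(j < d) psi (tnth x j).

Lemma weight_flip (b : 'I_d -> bool) x : weight (flip b x) = weight x.
Proof. by apply: eq_bigr => j _; rewrite tnth_flip; case: (b j). Qed.

Lemma weight_ge0 x : 0 <= weight x.
Proof. by rewrite prodr_ge0. Qed.

Lemma measurable_weight : measurable_fun setT weight.
Proof. exact: (measurable_prod_coord (fun _ : 'I_d => psi_meas)). Qed.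

Lemma flipK (b : 'I_d -> bool) : involutive (@flip R d b).
Proof.
move=> x; apply: eq_from_tnth => j; rewrite !tnth_flip.
by case: (b j); rewrite ?opprK.
Qed.

(** Every approximating tensor has a factor vanishing at 0 in coordinate j, and pointwise limits
    keep the value 0. *)
Lemma unit_ball_eq0 f x j : ball f -> tnth x j = 0 -> f x = 0.
Proof.
move=> [G [LG [f_ [G_ [af rG cvf cvG]]]] G1] xj.
have := cvf x; have -> : (fun n => f_ n x) = fun=> 0.
  apply/funext => n; have [m [g [sg ->]]] := af n.
  rewrite big1 // => k _; rewrite (bigD1 j) //= xj.
  by have [/(_ 0%N (ltn0Sn r)) /= -> _ _ _] := sg k j; rewrite mul0r.
move=> H; apply/esym; apply: (cvg_unique _ (@cvg_cst _ _ _ _ _) H).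
exact: norm_hausdorff.
Qed.

(** The term b = [orthant x] suffices: it reflects x into the positive orthant without changing the
    weight. *)
Lemma weight_le_sum x : weight x <= \sum_(b : signs) weight_pos psi (flip b x).
Proof.
rewrite (bigD1 (orthant x)) //= -[leLHS]addr0 lerD ?sumr_ge0 //; last first.
  by move=> b _; exact: weight_pos_ge0.
apply: ler_prod => j _; rewrite psi_ge0 /= tnth_flip /psi_pos ffunE.
by case: ltP => xj; rewrite ?oppr_ge0 ?(ltW xj) ?xj // -psi_sym.
Qed.

Lemma integral_unit_ball_bound : exists C : R, forall f, ball f ->
  (\int[mud]_x (`|f x| * weight x)%:E <= C%:E)%E.
Proof.
have [C C0 HC] := unit_ball_weight_bound d q_gt1 pq_conj psi_ge0 psi_meas psi_fin.
(* One copy of the positive-orthant bound for each of the 2^d orthants. *)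
exists (\sum_(b : signs) C) => f bf.
have mf := unit_ball_measurable bf.
have mF (b : signs) : measurable_fun setT (fun x => (`|f x| * weight_pos psi (flip b x))%:E).
  apply/measurable_EFinP; apply: measurable_funM; first exact: measurableT_comp.
  exact: (measurableT_comp (measurable_weight_pos psi_meas) (@measurable_flip _ _ b)).
have F0 (b : signs) x : (0 <= (`|f x| * weight_pos psi (flip b x))%:E)%E.
  by rewrite lee_fin mulr_ge0 // weight_pos_ge0.
apply: (@le_trans _ _ (\int[mud]_x \sum_(b : signs) (`|f x| * weight_pos psi (flip b x))%:E)%E).
  apply: ge0_le_integral => //.
  - by move=> x _; rewrite lee_fin mulr_ge0 // weight_ge0.
  - apply/measurable_EFinP; apply: measurable_funM; last exact: measurable_weight.
    exact: measurableT_comp.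
  - exact: emeasurable_sum.
  - move=> x _; rewrite sumEFin lee_fin -mulr_sumr ler_wpM2l //.
    exact: weight_le_sum.
rewrite ge0_integral_sum // -sumEFin; apply: lee_sum => b _.
rewrite -(ge0_integral_measure_preserving (@measure_preserving_flip R d b) (mF b) (F0 b)).
(* With all orthants kept, folding is plain reflection, so the reflected [f] stays in the ball. *)
apply: le_trans (HC _ (fold_orthants_unit_ball q_ge1 b [set: signs]%SET bf)).
rewrite le_eqVlt; apply/orP; left; apply/eqP; apply: eq_integral => x _.
by rewrite flipK /fold_orthants inE mul1r.
Qed.

Lemma integrable_unit_ball f : ball f -> mud.-integrable setT (fun x => (f x * weight x)%:E).
Proof.
move=> bf; have [C HC] := integral_unit_ball_bound.
apply/integrableP; split.
  apply/measurable_EFinP; apply: measurable_funM; last exact: measurable_weight.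
  exact: unit_ball_measurable bf.
apply: le_lt_trans (ltry C); apply: le_trans (HC _ bf).
rewrite le_eqVlt; apply/orP; left; apply/eqP; apply: eq_integral => x _.
by rewrite abse_EFin normrM (ger0_norm (weight_ge0 x)).
Qed.

Lemma initial_error_lty : (initial_error r.+1 q psi d < +oo)%E.
Proof.
have [C HC] := integral_unit_ball_bound.
apply: le_lt_trans (ltry C); apply: ge_ereal_sup => _ [f bf <-].
have /integrableP[mf _] := integrable_unit_ball bf.
apply: le_trans (le_abse_integral mud measurableT mf) _.
apply: le_trans (HC _ bf).
rewrite le_eqVlt; apply/orP; left; apply/eqP; apply: eq_integral => x _.
by rewrite abse_EFin normrM (ger0_norm (weight_ge0 x)).
Qed.

(** Off the coordinate hyperplanes, the sign vector of [flip b x] is the exclusive or of b with that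
    of x, a bijection in b. *)
Lemma card_orthant_flip S x : (forall j, tnth x j != 0) ->
  (\sum_(b : signs) (orthant (flip b x) \in S) = #|S|)%N.
Proof.
move=> x0; pose s b : signs := [ffun j => b j (+) (tnth x j < 0)].
have sK : involutive s by move=> b; apply/ffunP => j; rewrite !ffunE addbK.
rewrite (reindex_inj (inv_inj sK)) /= -sum1_card [RHS]big_mkcond /=.
apply: eq_bigr => b _; rewrite (_ : orthant _ = b); first by case: (b \in S).
apply/ffunP => j; rewrite !ffunE tnth_flip ffunE.
have [xj|xj|/eqP] := ltgtP (tnth x j) 0; last by rewrite (negbTE (x0 j)).
  by rewrite addbT; case: (b j); rewrite /= ?xj // oppr_lt0 ltNge (ltW xj).
by rewrite addbF; case: (b j); rewrite ?oppr_lt0 // ltNge (ltW xj).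
Qed.

(* Reflecting back, the integrals over the orthants of S, summed over all
   reflections b, count every orthant #|S| times; the hyperplanes between the
   orthants do not matter because f vanishes there. *)
Lemma sum_integral_fold_orthants S f : ball f ->
  (\sum_(b : signs) weighted_integral psi (fold_orthants b S f) =
   #|S|%:R%:E * weighted_integral psi f)%E.
Proof.
move=> bf; have If := integrable_unit_ball bf.
have /integrableP[mf _] := If.
pose F b x : R := (orthant (flip b x) \in S)%:R * (f x * weight x).
have mF b : measurable_fun setT (fun x => (F b x)%:E).
  apply/measurable_EFinP; apply: measurable_funM; last exact/measurable_EFinP.
  exact: (measurableT_comp (measurable_orthant S) (@measurable_flip _ _ b)).
have IF b : mud.-integrable setT (fun x => (F b x)%:E).
  apply: le_integrable If => // x _; rewrite /F !abse_EFin lee_fin normrM.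
  by case: (_ \in S); rewrite ?normr1 ?mul1r // normr0 mul0r.
rewrite (eq_bigr (fun b => \int[mud]_x (F b x)%:E)%E); last first.
  move=> b _; rewrite -(integral_measure_preserving (@measure_preserving_flip R d b) (mF b)).
  by apply: eq_integral => x _; rewrite /F flipK weight_flip mulrA.
rewrite -integral_sum // -integralZl //; apply: eq_integral => x _.
rewrite sumEFin -mulr_suml -natr_sum -EFinM.
have [x0|/existsNP[j /negP/negPn/eqP xj]] := pselect (forall j, tnth x j != 0).
  by rewrite card_orthant_flip.
by rewrite (unit_ball_eq0 bf xj) mul0r !mulr0.
Qed.

Lemma initial_error_le_worst_case N (a : 'I_N -> R) (x : 'I_N -> Rn R d) : (N < 2 ^ d)%N ->
  (initial_error r.+1 q psi d <=
   (2 ^+ d / (2 ^+ d - N%:R))%:E * worst_case_error r.+1 q psi a x)%E.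
Proof.
move=> Nd; have Nd' : 0 < 2 ^+ d - N%:R :> R by rewrite subr_gt0 -natrX ltr_nat.
have c0 : 0 < 2 ^+ d / (2 ^+ d - N%:R) :> R by rewrite divr_gt0 ?exprn_gt0.
apply: ge_ereal_sup => _ [f bf <-].
pose S : {set signs} := ~: [set orthant (x k) | k in 'I_N].
have cS : 2 ^+ d - N%:R <= #|S|%:R :> R.
  rewrite lerBlDr -natrX -natrD ler_nat.
  have := cardsC [set orthant (x k) | k in 'I_N]; rewrite card_ffun card_bool card_ord => <-.
  by rewrite addnC leq_add2l (leq_trans (leq_imset_card _ _)) // card_ord.
have wce_ge b : (`|weighted_integral psi (fold_orthants b S f)| <=
    worst_case_error r.+1 q psi a x)%E.
  apply: ereal_sup_ubound; exists (fold_orthants b S f).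
    exact: fold_orthants_unit_ball.
  rewrite /linear_algorithm big1 ?sube0 // => k _.
  by rewrite /fold_orthants !inE imset_f // mul0r mulr0.
have fin g : ball g -> weighted_integral psi g \is a fin_num.
  by move=> bg; exact: (integrable_fin_num measurableT (integrable_unit_ball bg)).
(* The worst-case error is not known to be finite: +oo makes the bound trivial, and -oo is excluded
   because the error dominates an absolute value. *)
case: (worst_case_error r.+1 q psi a x) wce_ge => [w| |] wce_ge.
- have := sum_integral_fold_orthants S bf.
  rewrite -(fineK (fin _ bf)) (eq_bigr (fun b =>
    (fine (weighted_integral psi (fold_orthants b S f)))%:E)); last first.
    by move=> b _; rewrite fineK // fin //; exact: fold_orthants_unit_ball.
  rewrite sumEFin -EFinM => -[sumE].
  rewrite abse_EFin lee_fin mulrAC ler_pdivlMr // mulrC.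
  apply: (@le_trans _ _ (#|S|%:R * `|fine (weighted_integral psi f)|)); first exact: ler_wpM2r.
  rewrite -[X in X * _]ger0_norm // -normrM -sumE.
  apply: le_trans (ler_norm_sum _ _ _) _.
  apply: (@le_trans _ _ (\sum_(b : signs) w)).
    apply: ler_sum => b _; rewrite -lee_fin -abse_EFin fineK ?wce_ge //.
    by apply: fin; exact: fold_orthants_unit_ball.
  by rewrite sumr_const card_ffun card_bool card_ord -natrX mulr_natl.
- by rewrite gt0_muley ?lte_fin // leey.
- by have := wce_ge [ffun=> false]; rewrite leeNy_eq; case: (weighted_integral _ _).
Qed.

Hypothesis psi_int1 : (\int[mu]_x (psi x)%:E = 1)%E.

Lemma information_complexity_ge (eps : R) : 0 < eps ->
  ((2 ^+ d * (1 - eps))%:E <= information_complexity r.+1 q psi eps d)%E.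
Proof.
move=> eps0; apply: le_ereal_inf_tmp => _ [N [_ Ne] <-]; rewrite lee_fin.
(* With at least 2^d nodes the claim is immediate, as 1 - eps <= 1; otherwise some orthant contains
   no node. *)
have [dN|Nd] := leqP (2 ^ d) N.
  apply: (@le_trans _ _ (2 ^+ d)); last by rewrite -natrX ler_nat.
  by rewrite ler_piMr ?exprn_ge0 // lerBlDr lerDl ltW.
have Nd' : 0 < 2 ^+ d - N%:R :> R by rewrite subr_gt0 -natrX ltr_nat.
have d0 : 0 < 2 ^+ d :> R by rewrite exprn_gt0.
have e_gt0 := @initial_error_gt0 R d r q psi q_ge1 psi_meas psi_ge0 psi_int1 psi_sym.
have e_lty := initial_error_lty.
have e_fin : initial_error r.+1 q psi d \is a fin_num by rewrite ge0_fin_numE // ltW.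
have : (((2 ^+ d - N%:R) / 2 ^+ d)%:E * initial_error r.+1 q psi d <=
    eps%:E * initial_error r.+1 q psi d)%E.
  apply: le_trans Ne; apply: le_ereal_inf_tmp => _ [a [x ->]].
  rewrite -[((_ - _) / _)]invf_div lee_pdivrMl ?divr_gt0 //.
  exact: initial_error_le_worst_case.
(* The initial error, positive and finite, cancels and leaves 2^d - N <= eps * 2^d. *)
rewrite -(fineK e_fin) -!EFinM lee_fin ler_pM2r; last by rewrite -lte_fin fineK.
rewrite ler_pdivrMr // => H; rewrite mulrBr mulr1 mulrC.
lra.
Qed.

End lower_bound.

Theorem corollary4 (R : realType) (q : \bar R) (p : R) (r : nat) (psi : R -> R)
    (q_gt1 : (1 < q)%E)
    (pq_conj : (p%:E^-1 + q^-1 = 1)%E)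
    (r_ge1 : (1 <= r)%N)
    (psi_meas : measurable_fun [set: measurableTypeR R] psi)
    (psi_ge0 : forall x, 0 <= psi x)
    (psi_int1 : (\int[lebesgue_measure]_x (psi x)%:E = 1)%E)
    (psi_sym : forall x, psi x = psi (- x))
    (psi_fin : psi_condition r p psi) :
  curse_of_dimensionality r q psi /\
  (forall (eps : R) (d : nat), 0 < eps < 1 -> (1 <= d)%N ->
     ((2 ^+ d * (1 - eps))%:E <= information_complexity r q psi eps d)%E).
Proof.
case: r r_ge1 psi_fin => // r _ psi_fin.
have lower (eps : R) d : 0 < eps ->
    ((2 ^+ d * (1 - eps))%:E <= information_complexity r.+1 q psi eps d)%E.
  by move=> eps0; exact: (information_complexity_ge d q_gt1 pq_conj psi_ge0 psi_meas
    psi_sym psi_fin psi_int1 eps0).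
split; last by move=> eps d /andP[eps0 _] _; exact: lower.
(* For eps = 1/2 the lower bound is 2^d / 2, that is C = 1/2 and growth rate 1 + 1. *)
exists 2^-1, 2^-1, 1; split => [| | |d _]; rewrite ?invr_gt0 //.
have -> : 2^-1 * (1 + 1) ^+ d = 2 ^+ d * (1 - 2^-1) :> R by field.
by apply: lower; rewrite invr_gt0.
Qed.
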